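(* Let $V$ be a real vector space with a generalized complex structure $E\subset V_{\mathbb C}\oplus V_{\mathbb C}^*$. Let $W\subseteq V$ be any subspace, and let $j:W\hookrightarrow V$ denote the inclusion map. Then there exists a representative spinor for $E$ of the form $\phi=\exp(u)\wedge f_1\wedge\dotsb\wedge f_k$, with $u\in\bigwedge^2V_{\mathbb C}^*$ and $f_1,\dots,f_k\in V_{\mathbb C}^*$, such that, for some $0\le l\le k$, $j^*(f_1),\dotsc,j^*(f_l)$ are a basis of $\operatorname{Ann}\bigl(\rho(E)\cap W_{\mathbb C}\bigr)\subseteq W_{\mathbb C}^*$, and $f_{l+1},\dotsc,f_k$ are a basis of $\operatorname{Ann}\bigl(\rho(E)+W_{\mathbb C}\bigr)\subseteq V_{\mathbb C}^*$. Moreover, $\phi_W:=\exp(j^*u)\wedge j^*(f_1)\wedge\dotsb\wedge j^*(f_l)$ is a representative spinor for $E_W$. In particular, $W$ is a generalized complex subspace of $V$ if and only if $\langle\phi_W,\bar\phi_W\rangle_M\neq0$.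
   Context: All vector spaces are finite-dimensional. For a real vector space $V$, $V_{\mathbb C}$ is its complexification, with complex conjugation. $\operatorname{Ann}$ denotes the annihilator. On $V_{\mathbb C}\oplus V_{\mathbb C}^*$ use the pairing $\langle v+f,w+g\rangle=-\tfrac12(f(w)+g(v))$. A generalized complex (GC) structure on $V$ is a maximally isotropic complex subspace $E\subset V_{\mathbb C}\oplus V_{\mathbb C}^*$ with $E\cap\overline E=(0)$. $\rho:V_{\mathbb C}\oplus V_{\mathbb C}^*\to V_{\mathbb C}$ is the projection. For a real subspace $W\subseteq V$ put $E_W=\{(w,f|_{W_{\mathbb C}}) : (w,f)\in E\cap(W_{\mathbb C}\oplus V_{\mathbb C}^* )\}$, which is always a maximally isotropic subspace of $W_{\mathbb C}\oplus W_{\mathbb C}^*$. $W$ is a GC subspace if $E_W\cap\overline{E_W}=(0)$. Spinors: $V_{\mathbb C}\oplus V_{\mathbb C}^*$ acts on the space of spinors $\bigwedge^\bullet V_{\mathbb C}^*$ by $(v+f)\cdot\phi=\iota_v\phi+f\wedge\phi$. For a maximally isotropic $E$, a representative spinor for $E$ is a nonzero $\phi\in\bigwedge^\bullet V_{\mathbb C}^*$ whose annihilator $\{e: e\cdot\phi=0\}$ equals $E$ (such a $\phi$ is unique up to a nonzero scalar). Complex conjugation acts on spinors. Mukai pairing: for $\phi,\psi\in\bigwedge^\bullet W_{\mathbb C}^*$, $n=\dim W$, $\langle\phi,\psi\rangle_M\in\bigwedge^nW_{\mathbb C}^*$ is the degree-$n$ component of $\sigma(\phi)\wedge\psi$, where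 $\sigma$ is the anti-automorphism of the exterior algebra that is the identity on degree-one elements. *)

(* Defs.v *)
From HB Require Import structures.
From mathcomp Require Import all_boot all_order all_algebra.
From mathcomp Require Import complex reals zify ring.

Set Implicit Arguments.
Unset Strict Implicit.
Unset Printing Implicit Defensive.

Import Order.TTheory GRing.Theory Num.Theory.
Local Open Scope ring_scope.

(* The exterior algebra on n generators e_0, ..., e_(n-1): an element is the
   family of its coefficients on the basis e_S, where for
   S = {i_1 < ... < i_k} the basis element e_S is e_(i_1) /\ ... /\ e_(i_k).
   The ring product is the wedge product; the universal property is given by
   [ext_lift_var], [ext_lift_mul] and [ext_lift_unique] below. *)
Definition ext (F : comNzRingType) (n : nat) : Type :=
  {ffun {set 'I_n} -> F^o}.

HB.instance Definition _ (F : comNzRingType) n :=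
  GRing.Lmodule.copy (ext F n) {ffun {set 'I_n} -> F^o}.

(* Number of transpositions needed to sort e_S /\ e_T. *)
Definition inversions n (S T : {set 'I_n}) : nat :=
  \sum_(i in S) \sum_(j in T) (j < i)%N.

Section ExtRing.
Variables (F : comNzRingType) (n : nat).
Implicit Types (a b c : ext F n) (S T U : {set 'I_n}).

Definition ext_basis S : ext F n := [ffun T => (T == S)%:R].

Definition ext_mul a b : ext F n :=
  [ffun U : {set 'I_n} => \sum_(S : {set 'I_n} | S \subset U)
     (-1) ^+ inversions S (U :\: S) * (a S * b (U :\: S))].

Lemma sum_disjointU S T (f : 'I_n -> nat) : [disjoint S & T] ->
  (\sum_(i in S :|: T) f i = \sum_(i in S) f i + \sum_(i in T) f i)%N.
Proof.
move=> dST; rewrite -(@bigU _ _ _ _ (mem S) (mem T)) //=.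
by apply: eq_bigl => i; rewrite !inE.
Qed.

Lemma inversionsUl S T U : [disjoint S & T] ->
  inversions (S :|: T) U = (inversions S U + inversions T U)%N.
Proof. exact: sum_disjointU. Qed.

Lemma inversionsUr S T U : [disjoint S & T] ->
  inversions U (S :|: T) = (inversions U S + inversions U T)%N.
Proof.
move=> dST; rewrite /inversions -big_split /=.
by apply: eq_bigr => i _; rewrite sum_disjointU.
Qed.

Lemma inversions0l T : inversions set0 T = 0%N.
Proof. by rewrite /inversions big_set0. Qed.

Lemma inversions0r T : inversions T set0 = 0%N.
Proof. by rewrite /inversions big1 // => i _; rewrite big_set0. Qed.

Lemma inversions1l i T : inversions [set i] T = (\sum_(j in T) (j < i))%N.
Proof. by rewrite /inversions big_set1. Qed.

Fact ext_mulA : associative ext_mul.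
Proof.
move=> a b c; apply/ffunP => U; rewrite !ffunE.
under eq_bigr => S sSU do rewrite ffunE !mulr_sumr.
under [RHS]eq_bigr => T sTU do rewrite ffunE mulr_suml mulr_sumr.
rewrite [RHS](exchange_big_dep (fun S => S \subset U)) /=; last first.
  by move=> T S sTU sST; apply: subset_trans sST sTU.
apply: eq_bigr => S sSU.
rewrite [RHS](reindex_onto (fun Q => S :|: Q) (fun T => T :\: S)) /=; last first.
  by move=> T /andP[_ sST]; rewrite -[RHS](setID T S) (setIidPr sST).
have dE (Q : {set 'I_n}) : ((S :|: Q) :\: S == Q) = [disjoint S & Q].
  by rewrite setDUl setDv set0U disjoint_sym; apply/eqP/setDidPl.
apply: eq_big => [Q|Q].
  rewrite dE subUset sSU subsetUl andbT /= subsetD; congr (_ && _).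
  by rewrite disjoint_sym.
rewrite subsetD disjoint_sym => /andP[sQU dSQ].
have /eqP-> : (S :|: Q) :\: S == Q by rewrite dE.
have -> : U :\: S :\: Q = U :\: (S :|: Q) by rewrite setDDl.
have -> : U :\: S = Q :|: (U :\: (S :|: Q)).
  rewrite -setDDl -{1}(setID (U :\: S) Q); congr (_ :|: _).
  by apply/setIidPr; rewrite subsetD sQU disjoint_sym.
rewrite inversionsUr ?inversionsUl //; last first.
  by rewrite disjoint_sym -setDDl disjoints_subset setDE subsetIr.
set x := inversions _ _; set y := inversions _ _; set z := inversions _ _.
rewrite !exprD /GRing.scale /=; ring.
Qed.

Fact ext_mul1l : left_id (ext_basis set0) ext_mul.
Proof.
move=> a; apply/ffunP => U; rewrite ffunE (bigD1 set0) ?sub0set //=.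
rewrite inversions0l ffunE eqxx setD0 !mul1r big1 ?addr0 // => S /andP[_ nS].
by rewrite ffunE (negPf nS) mul0r mulr0.
Qed.

Fact ext_mul1r : right_id (ext_basis set0) ext_mul.
Proof.
move=> a; apply/ffunP => U; rewrite ffunE (bigD1 U) //=.
rewrite setDv inversions0r ffunE eqxx mulr1 mul1r big1 ?addr0 //.
move=> S /andP[sSU nS]; rewrite ffunE setD_eq0 (_ : U \subset S = false) ?mulr0 //.
by apply: contraNF nS => sUS; rewrite eqEsubset sSU.
Qed.

Fact ext_mulDl : left_distributive ext_mul +%R.
Proof.
move=> a b c; apply/ffunP => U; rewrite !ffunE -big_split /=.
by apply: eq_bigr => S _; rewrite ffunE mulrDl mulrDr.
Qed.

Fact ext_mulDr : right_distributive ext_mul +%R.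
Proof.
move=> a b c; apply/ffunP => U; rewrite !ffunE -big_split /=.
by apply: eq_bigr => S _; rewrite ffunE !mulrDr.
Qed.

Fact ext1_neq0 : ext_basis set0 != 0.
Proof. by apply/eqP => /ffunP/(_ set0)/eqP; rewrite !ffunE eqxx oner_eq0. Qed.

HB.instance Definition _ := GRing.Zmodule_isNzRing.Build (ext F n)
  ext_mulA ext_mul1l ext_mul1r ext_mulDl ext_mulDr ext1_neq0.

Fact ext_scaleAl (k : F) a b : k *: (a * b) = k *: a * b.
Proof.
apply/ffunP => U; rewrite !ffunE scaler_sumr; apply: eq_bigr => S _.
by rewrite ffunE /GRing.scale /= mulrCA -!mulrA.
Qed.

HB.instance Definition _ :=
  GRing.Lmodule_isLalgebra.Build F (ext F n) ext_scaleAl.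

Fact ext_scaleAr (k : F) a b : k *: (a * b) = a * (k *: b).
Proof.
apply/ffunP => U; rewrite !ffunE scaler_sumr; apply: eq_bigr => S _.
by rewrite ffunE /GRing.scale /=; ring.
Qed.

HB.instance Definition _ :=
  GRing.Lalgebra_isAlgebra.Build F (ext F n) ext_scaleAr.

Definition ext_var (i : 'I_n) : ext F n := ext_basis [set i].

Lemma ext_mulE a b U : (a * b) U = \sum_(S : {set 'I_n} | S \subset U)
   (-1) ^+ inversions S (U :\: S) * (a S * b (U :\: S)).
Proof. by rewrite ffunE. Qed.

Lemma ext_sum_basis a : a = \sum_S a S *: ext_basis S.
Proof.
apply/ffunP => U; rewrite sum_ffunE (bigD1 U) //= !ffunE eqxx big1 => [|S nS].
  by rewrite addr0 /GRing.scale /= mulr1.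
by rewrite !ffunE eq_sym (negPf nS) scaler0.
Qed.

Lemma ext_var_mulE i a U : (ext_var i * a) U =
  if i \in U then (-1) ^+ (\sum_(j in U :\ i) (j < i))%N * a (U :\ i) else 0.
Proof.
rewrite ext_mulE; case: ifP => iU; last first.
  rewrite big1 // => S sSU; rewrite ffunE; case: eqP => [eS|]; last first.
    by rewrite mul0r mulr0.
  by move: sSU; rewrite eS sub1set iU.
rewrite (bigD1 [set i]) ?sub1set //= ffunE eqxx inversions1l mul1r.
rewrite [X in _ + X]big1 ?addr0 // => S /andP[_ nS].
by rewrite ffunE (negPf nS) mul0r mulr0.
Qed.

Lemma ext_var_basis i S : ext_var i * ext_basis S =
  if i \in S then 0 else (-1) ^+ (\sum_(j in S) (j < i))%N *: ext_basis (i |: S).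
Proof.
apply/ffunP => U; rewrite ext_var_mulE; case: ifP => [iU|iU]; last first.
  case: ifP => iS; rewrite !ffunE //; case: eqP => [eU|]; last by rewrite scaler0.
  by move: iU; rewrite eU setU11.
case: ifP => iS; rewrite !ffunE.
  by case: eqP iS => [<-|]; rewrite ?mulr0 // setD11.
case: (U =P _) => [->|nU]; first by rewrite setU1K ?iS // eqxx.
by case: eqP => [eS|]; rewrite ?scaler0 ?mulr0 //; case: nU; rewrite -eS setD1K.
Qed.

Lemma ext_varK i : ext_var i * ext_var i = 0.
Proof. by rewrite ext_var_basis set11. Qed.

Lemma ext_varC i j : ext_var i * ext_var j = - (ext_var j * ext_var i).
Proof.
rewrite !ext_var_basis !inE (eq_sym i); case: eqP => [|/eqP nij]; rewrite ?oppr0 //.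
rewrite !big_set1 setUC -scaleNr; congr (_ *: _).
by move: nij; rewrite -val_eqE /=; case: ltngtP => //= _ _; rewrite ?opprK.
Qed.

Lemma ext_basis_min S : S != set0 ->
  exists2 i, i \in S & ext_basis S = ext_var i * ext_basis (S :\ i).
Proof.
case/set0Pn => i0 i0S.
case: (@arg_minnP _ i0 (mem S) val i0S) => i /= iS min_i; exists i => //.
rewrite ext_var_basis setD11 setD1K // big1 ?scale1r // => j.
by rewrite 2!inE => /andP[_ /min_i]; case: ltngtP.
Qed.

(* Contraction with the vector whose coordinates are v, where e_0, ..., e_(n-1)
   is read as the dual basis: the antiderivation with e_i |-> v i. *)
Definition ext_contract (v : 'I_n -> F) a : ext F n :=
  [ffun S : {set 'I_n} => \sum_(i | i \notin S)
     (-1) ^+ (\sum_(j in S) (j < i))%N * (v i * a (i |: S))].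

Lemma ext_contractE v a (S : {set 'I_n}) : ext_contract v a S =
  \sum_(i | i \notin S)
     (-1) ^+ (\sum_(j in S) (j < i))%N * (v i * a (i |: S)).
Proof. by rewrite ffunE. Qed.

Lemma ext_addE a b S : (a + b) S = a S + b S. Proof. exact: ffunE. Qed.
Lemma ext_oppE a S : (- a) S = - a S. Proof. exact: ffunE. Qed.
Lemma ext_scaleE k a S : (k *: a) S = k * a S. Proof. exact: ffunE. Qed.

Fact ext_contract_is_linear v : linear (ext_contract v).
Proof.
move=> k a b; apply/ffunP => U; rewrite !ffunE scaler_sumr -big_split /=.
by apply: eq_bigr => i _; rewrite !ffunE /GRing.scale /=; ring.
Qed.

HB.instance Definition _ v := GRing.isLinear.Build F (ext F n) (ext F n) *:%R
  (ext_contract v) (ext_contract_is_linear v).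

Lemma ext_contract_basis0 v : ext_contract v 1 = 0.
Proof.
apply/ffunP => S; rewrite !ffunE big1 // => i _; rewrite ffunE.
by case: eqP => [/setP/(_ i)|]; rewrite ?setU11 ?inE // !mulr0.
Qed.

Lemma ext_contract_var v k a :
  ext_contract v (ext_var k * a) = v k *: a - ext_var k * ext_contract v a.
Proof.
apply/ffunP => S; rewrite ext_addE ext_oppE ext_scaleE ext_contractE ext_var_mulE.
case kS: (k \in S); last first.
  rewrite subr0 (bigD1 k) ?kS //= ext_var_mulE setU11 setU1K ?kS //.
  rewrite [X in _ + X]big1 => [|i /andP[iS nik]].
    rewrite addr0 mulrCA [_ * (_ * a S)]mulrA -exprMn mulrNN mulr1 expr1n mul1r.
    by [].
  by rewrite ext_var_mulE !inE eq_sym (negPf nik) kS !mulr0.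
set e := (X in _ - X * _).
have ee : e * e = 1 by rewrite /e -exprMn mulrNN mulr1 expr1n.
rewrite ext_contractE [in RHS](bigD1 k) ?setD11 //= setD1K // mulrDr opprD addrA.
rewrite mulrA ee mul1r subrr add0r mulr_sumr -sumrN; apply: eq_big => [i|i iS].
  by rewrite !inE; case: eqVneq => [->|] //=; rewrite ?kS ?andbT.
have nik : i != k by apply: contraNneq iS => ->.
rewrite ext_var_mulE !inE kS orbT.
have -> : (i |: S) :\ k = i |: (S :\ k).
  apply/setP => j; rewrite !inE; case: (eqVneq j k) => // ->.
  by rewrite eq_sym (negPf nik).
rewrite big_setU1 ?inE ?(negPf iS) ?andbF //= (big_setD1 k kS) /= !exprD -/e.
have -> : (-1) ^+ (k < i)%N = - (-1) ^+ (i < k)%N :> F.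
  by move: nik; rewrite -val_eqE /=; case: ltngtP => //= _ _; rewrite ?opprK.
by case: (i < k)%N; rewrite ?expr0 ?expr1; ring.
Qed.

(* The anti-automorphism fixing the generators; it reverses the order of the
   k factors of e_S, and 'C(k, 2) is the length of that permutation. *)
Definition ext_rev a : ext F n :=
  [ffun S : {set 'I_n} => (-1) ^+ 'C(#|S|, 2) * a S].

Lemma inversions_swap S T : [disjoint S & T] ->
  (inversions S T + inversions T S)%N = (#|S| * #|T|)%N.
Proof.
move=> dST; rewrite /inversions [X in (_ + X)%N]exchange_big -big_split /=.
rewrite -sum_nat_const; apply: eq_bigr => i iS.
rewrite -big_split /= -sum1_card; apply: eq_bigr => j jT.
have := disjointFr dST iS; case: (ltngtP j i) => //= /val_inj eij.
by rewrite -eij jT.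
Qed.

Lemma ext_rev_mul a b : ext_rev (a * b) = ext_rev b * ext_rev a.
Proof.
apply/ffunP => U; rewrite ffunE !ext_mulE mulr_sumr.
rewrite [RHS](reindex_onto (fun S => U :\: S) (fun S => U :\: S)) /=; last first.
  by move=> S sSU; rewrite setDDr setDv set0U (setIidPr sSU).
apply: eq_big => [S|S sSU].
  by rewrite subsetDl setDDr setDv set0U; apply/setIidPr/eqP.
have -> : U :\: (U :\: S) = S by rewrite setDDr setDv set0U (setIidPr sSU).
have dS : [disjoint S & U :\: S] by rewrite disjoint_sym disjoints_subset setDE subsetIr.
have -> : #|U| = (#|S| + #|U :\: S|)%N by rewrite cardsD (setIidPr sSU) subnKC // subset_leq_card.
have sgn2 k : (-1) ^+ k * (-1) ^+ k = 1 :> F.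
  by rewrite -exprMn mulrNN mulr1 expr1n.
have -> : (-1) ^+ inversions S (U :\: S) =
    (-1) ^+ (#|S| * #|U :\: S|) * (-1) ^+ inversions (U :\: S) S :> F.
  by rewrite -inversions_swap // exprD -mulrA sgn2 mulr1.
have -> : 'C(#|S| + #|U :\: S|, 2) =
   ('C(#|S|, 2) + 'C(#|U :\: S|, 2) + #|S| * #|U :\: S|)%N.
  elim: #|S| => [|m IH]; first by rewrite bin0n !add0n mul0n addn0.
  rewrite addSn !binS !bin1 IH mulSn; lia.
rewrite !ffunE !exprD -!mulrA [X in _ * (_ * X)]mulrA sgn2; ring.
Qed.

Lemma ext_rev_var i : ext_rev (ext_var i) = ext_var i.
Proof.
apply/ffunP => S; rewrite !ffunE.
by case: eqP => [->|]; rewrite ?mulr0 // cards1 mul1r.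
Qed.

End ExtRing.

Definition ext_lift (F : comNzRingType) n (A : algType F) (g : 'I_n -> A)
  (a : ext F n) : A := \sum_(S : {set 'I_n}) a S *: \prod_(i in S) g i.

Section ExtLift.
Variables (F : comNzRingType) (n : nat) (A : algType F) (g : 'I_n -> A).

Fact ext_lift_is_linear : linear (ext_lift g).
Proof.
move=> k a b; rewrite /ext_lift scaler_sumr -big_split /=.
by apply: eq_bigr => S _; rewrite !ffunE scalerDl scalerA.
Qed.

HB.instance Definition _ :=
  GRing.isLinear.Build F (ext F n) A *:%R (ext_lift g) ext_lift_is_linear.

Lemma ext_lift_basis S : ext_lift g (ext_basis F S) = \prod_(i in S) g i.
Proof.
rewrite /ext_lift (bigD1 S) //= ffunE eqxx scale1r [X in _ + X]big1 ?addr0 // => T nT.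
by rewrite ffunE (negPf nT) scale0r.
Qed.

Lemma ext_lift_var i : ext_lift g (ext_var F i) = g i.
Proof. by rewrite ext_lift_basis big_set1. Qed.

Lemma ext_lift1 : ext_lift g 1 = 1.
Proof. by rewrite ext_lift_basis big_set0. Qed.

Hypothesis gK : forall i, g i * g i = 0.
Hypothesis gC : forall i j, g i * g j = - (g j * g i).

Let gen_prod (r : seq 'I_n) (T : {set 'I_n}) i :
  sorted ltn (map val r) -> i \in r ->
  g i * \prod_(j <- r | j \in T) g j =
  if i \in T then 0 else
  (-1) ^+ (\sum_(j <- r | j \in T) (j < i))%N *:
    \prod_(j <- r | j \in i |: T) g j.
Proof.
elim: r => // x r IHr /= s_xr; rewrite inE.
have s_r : sorted ltn (map val r) by apply: path_sorted s_xr.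
have ltx j : j \in r -> (x < j)%N.
  move=> jr; move: s_xr; rewrite path_sortedE; last exact: ltn_trans.
  by case/andP => /allP/(_ (val j)) lt_x _; apply: lt_x; apply: map_f.
have [<- _|nxi /= ir] := eqVneq x i.
  have nxr : x \notin r by apply/negP => /ltx; rewrite ltnn.
  rewrite !big_cons in_setU1 eqxx /= ltnn; case xT: (x \in T).
    by rewrite mulrA gK mul0r.
  rewrite [X in _ ^+ X]big_seq_cond [X in _ ^+ X]big1 => [|j /andP[/ltx]]; last first.
    by case: ltngtP.
  rewrite scale1r; congr (_ * _); rewrite big_seq_cond [RHS]big_seq_cond.
  apply: eq_bigl => j; rewrite !inE; case: eqP => // ->.
  by rewrite (negPf nxr).
move/(_ s_r ir): IHr => IHr.
rewrite !big_cons in_setU1 (negPf nxi) /=; case xT: (x \in T) => //.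
rewrite mulrA gC mulNr -mulrA IHr; case: ifP => iT; first by rewrite mulr0 oppr0.
by rewrite ltx // exprS mulN1r scaleNr scalerAr.
Qed.

Lemma ext_lift_var_prod i (T : {set 'I_n}) : g i * \prod_(j in T) g j =
  if i \in T then 0 else
  (-1) ^+ (\sum_(j in T) (j < i))%N *: \prod_(j in i |: T) g j.
Proof.
have -> : index_enum 'I_n = enum 'I_n by rewrite enumT /index_enum unlock.
by apply: gen_prod; rewrite ?val_enum_ord ?mem_enum // iota_ltn_sorted.
Qed.

Let ext_lift_var_mul i a : ext_lift g (ext_var F i * a) = g i * ext_lift g a.
Proof.
rewrite (ext_sum_basis a) mulr_sumr !linear_sum mulr_sumr.
apply: eq_bigr => S _; rewrite -scalerAr !linearZ /= -scalerAr ext_var_basis.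
rewrite ext_lift_basis ext_lift_var_prod; case: ifP => _; rewrite ?linear0 //.
by rewrite linearZ /= ext_lift_basis.
Qed.

Lemma ext_lift_mul a b : ext_lift g (a * b) = ext_lift g a * ext_lift g b.
Proof.
rewrite (ext_sum_basis a) mulr_suml !linear_sum mulr_suml.
apply: eq_bigr => S _; rewrite -scalerAl !linearZ /= -scalerAl.
congr (_ *: _).
have [k] := ubnP #|S|; elim: k S => // k IHk S.
have [-> _|/(ext_basis_min F)[i iS defS] leSk] := eqVneq S set0.
  by rewrite ext_lift_basis big_set0 !mul1r.
rewrite defS -mulrA !ext_lift_var_mul IHk ?mulrA //.
by move: leSk; rewrite (cardsD1 i) iS.
Qed.

Lemma ext_lift_unique (h : {linear ext F n -> A}) :
    h 1 = 1 -> {morph h : a b / a * b} -> (forall i, h (ext_var F i) = g i) ->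
  h =1 ext_lift g.
Proof.
move=> h1 hM hg a; rewrite (ext_sum_basis a) !linear_sum.
apply: eq_bigr => S _; rewrite !linearZ /=; congr (_ *: _).
have [k] := ubnP #|S|; elim: k S => // k IHk S.
have [-> _|/(ext_basis_min F)[i iS defS] leSk] := eqVneq S set0.
  by rewrite ext_lift_basis big_set0 h1.
rewrite defS hM ext_lift_var_mul hg IHk //.
by move: leSk; rewrite (cardsD1 i) iS.
Qed.

End ExtLift.

Definition ext_part (F : comNzRingType) n (d : nat) (a : ext F n) : ext F n :=
  [ffun S : {set 'I_n} => if #|S| == d then a S else 0].

Definition ext_homogeneous (F : comNzRingType) n (d : nat) (a : ext F n) : Prop :=
  ext_part d a = a.

(* Elements of degree 2 are nilpotent and the sum contains all the nonzero
   terms of the exponential series, as u ^+ k has degree 2k. *)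
Definition ext_exp (F : fieldType) n (u : ext F n) : ext F n :=
  \sum_(k < n.+1) (k`!%:R)^-1 *: u ^+ k.

Definition ext_map (F : comNzRingType) n (h : F -> F) (a : ext F n) : ext F n :=
  [ffun S => h (a S)].

Lemma ext_map_mul (F : comNzRingType) n (h : {rmorphism F -> F}) :
  {morph @ext_map F n h : a b / a * b}.
Proof.
move=> a b; apply/ffunP => U; rewrite ffunE !ext_mulE rmorph_sum.
apply: eq_bigr => S _; rewrite !rmorphM /= rmorphXn rmorphN1 /=.
by congr (_ * (_ * _)); rewrite ffunE.
Qed.

Section DualMap.
Variables (F : fieldType) (U1 U2 : vectType F) (j : 'Hom(U1, U2)).

Definition dual_map (f : 'Hom(U2, F^o)) : 'Hom(U1, F^o) := (f \o j)%VF.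

Fact dual_map_is_linear : linear dual_map.
Proof.
move=> k f g; apply/lfunP => v.
by rewrite add_lfunE scale_lfunE !comp_lfunE add_lfunE scale_lfunE.
Qed.

HB.instance Definition _ := GRing.isLinear.Build F 'Hom(U2, F^o) 'Hom(U1, F^o)
  *:%R dual_map dual_map_is_linear.

End DualMap.

Section Spinors.
Variables (F : fieldType) (U : vectType F).
Implicit Types (f g : 'Hom(U, F^o)) (v w : U) (x y : U * 'Hom(U, F^o)).
Implicit Types (E : {vspace U * 'Hom(U, F^o)}) (phi psi : ext F (\dim {:U})).

Definition pairing x y : F := - 2%:R^-1 * (x.2 y.1 + y.2 x.1).

Definition isotropic E : Prop :=
  forall x y, x \in E -> y \in E -> pairing x y = 0.

Definition maximally_isotropic E : Prop :=
  isotropic E /\ forall E', isotropic E' -> (E <= E')%VS -> E' = E.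

Definition rho E : {vspace U} := (linfun fst @: E)%VS.

Lemma mem_rhoP E v : reflect (exists f, (v, f) \in E) (v \in rho E).
Proof.
apply: (iffP memv_imgP) => [[[w f] wfE ->]|[f vfE]].
  by exists f; rewrite lfunE.
by exists (v, f); rewrite ?lfunE.
Qed.

Definition ann (X : {vspace U}) : {vspace 'Hom(U, F^o)} :=
  lker (linfun (dual_map (linfun (vsval : subvs_of X -> U)))).

Lemma mem_annP (X : {vspace U}) f :
  reflect (forall v, v \in X -> f v = 0) (f \in ann X).
Proof.
rewrite memv_ker lfunE; apply: (iffP eqP) => [f0 v vX|f0].
  have /lfunP/(_ (vsproj X v)) := f0.
  by rewrite comp_lfunE lfunE zero_lfunE /= vsprojK.
apply/lfunP => v; rewrite comp_lfunE lfunE zero_lfunE /=.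
exact/f0/subvsP.
Qed.

(* U^* as the degree one part of /\ U^*: the generators of [ext] are the dual
   basis of vbasis {:U}. *)
Definition form1 f : ext F (\dim {:U}) :=
  \sum_(i < \dim {:U}) f (vbasis {:U})`_i *: ext_var F i.

Definition dual_basis (i : 'I_(\dim {:U})) : 'Hom(U, F^o) :=
  linfun (coord (vbasis {:U}) i : U -> F^o).

Definition contraction v phi : ext F (\dim {:U}) :=
  ext_contract (fun i => coord (vbasis {:U}) i v) phi.

Definition clifford x phi := contraction x.1 phi + form1 x.2 * phi.

Definition representative E phi : Prop :=
  phi != 0 /\ forall x, clifford x phi = 0 <-> x \in E.

Definition mukai phi psi := ext_part (\dim {:U}) (ext_rev phi * psi).

(* exp(u) /\ f_1 /\ ... /\ f_k *)
Definition exp_wedge (u : ext F (\dim {:U})) (fs : seq 'Hom(U, F^o)) :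
    ext F (\dim {:U}) := ext_exp u * \prod_(f <- fs) form1 f.

Fact form1_is_linear : linear form1.
Proof.
move=> k f g; rewrite /form1 scaler_sumr -big_split /=.
by apply: eq_bigr => i _; rewrite add_lfunE scale_lfunE scalerDl scalerA.
Qed.

HB.instance Definition _ := GRing.isLinear.Build F 'Hom(U, F^o)
  (ext F (\dim {:U})) *:%R form1 form1_is_linear.

Lemma form1_dual_basis i : form1 (dual_basis i) = ext_var F i.
Proof.
have fb := basis_free (vbasisP {:U}).
rewrite /form1 (bigD1 i) //= lfunE /= coord_free // eqxx scale1r big1 ?addr0 //.
by move=> k nki; rewrite lfunE /= coord_free // (negPf nki) scale0r.
Qed.

Lemma dual_basis_sum f : f = \sum_(i < \dim {:U}) f (vbasis {:U})`_i *: dual_basis i.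
Proof.
apply/lfunP => v; rewrite sum_lfunE [in LHS](coord_vbasis (memvf v)) linear_sum.
apply: eq_bigr => i _; rewrite linearZ scale_lfunE lfunE /=.
by rewrite /GRing.scale /= mulrC.
Qed.

Lemma form1C f g : form1 f * form1 g = - (form1 g * form1 f).
Proof.
rewrite /form1 mulr_suml mulr_sumr -sumrN; apply: eq_bigr => i _.
rewrite mulr_suml mulr_sumr -sumrN; apply: eq_bigr => k _.
by rewrite -!scalerAl -!scalerAr ext_varC !scalerN scalerA mulrC -scalerA.
Qed.

Lemma form1K f : form1 f * form1 f = 0.
Proof.
rewrite /form1; elim: (index_enum _) => [|i r IHr]; first by rewrite big_nil mul0r.
rewrite big_cons mulrDl !mulrDr IHr addr0 -scalerAl -scalerAr ext_varK !scaler0.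
rewrite add0r -scalerAl -scalerAr -scalerDr mulr_sumr mulr_suml -big_split /=.
rewrite big1 ?scaler0 // => k _.
by rewrite -scalerAl -scalerAr -scalerDr ext_varC addNr scaler0.
Qed.

Lemma contraction1 v : contraction v 1 = 0.
Proof. exact: ext_contract_basis0. Qed.

Lemma contraction_form1 v f phi :
  contraction v (form1 f * phi) = f v *: phi - form1 f * contraction v phi.
Proof.
rewrite /contraction /form1 !mulr_suml linear_sum.
under eq_bigr => i _.
  rewrite -scalerAl linearZ /= ext_contract_var scalerBr scalerA scalerAl.
  over.
rewrite sumrB; congr (_ - _); rewrite -scaler_suml; congr (_ *: _).
rewrite [in RHS](coord_vbasis (memvf v)) linear_sum.
by apply: eq_bigr => i _; rewrite linearZ /= mulrC.
Qed.

Lemma ext_rev_form1 f : ext_rev (form1 f) = form1 f.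
Proof.
apply/ffunP => S; rewrite ffunE /form1 sum_ffunE mulr_sumr; apply: eq_bigr => i _.
by rewrite ext_scaleE mulrCA -[in RHS](ext_rev_var F i) [in RHS]ffunE.
Qed.

End Spinors.

Section Pullback.
Variables (F : fieldType) (U1 U2 : vectType F) (j : 'Hom(U1, U2)).

(* The algebra morphism /\ U2^* -> /\ U1^* extending dual_map j. *)
Definition pullback : ext F (\dim {:U2}) -> ext F (\dim {:U1}) :=
  ext_lift (fun i => form1 (dual_map j (dual_basis i))).

Lemma pullback_form1 f : pullback (form1 f) = form1 (dual_map j f).
Proof.
rewrite [in RHS](dual_basis_sum f) !linear_sum /pullback {1}/form1 linear_sum.
by apply: eq_bigr => i _; rewrite !linearZ /= ext_lift_var.
Qed.

Lemma pullback1 : pullback 1 = 1.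
Proof. exact: ext_lift1. Qed.

Lemma pullback_mul : {morph pullback : a b / a * b}.
Proof.
by move=> a b; apply: ext_lift_mul => *; [apply: form1K | apply: form1C].
Qed.

(* (U1 (+) U2^* ) \cap E, pushed to U1 (+) U1^*. *)
Definition restriction (E : {vspace U2 * 'Hom(U2, F^o)}) :
    {vspace U1 * 'Hom(U1, F^o)} :=
  (linfun (fun x : U1 * 'Hom(U2, F^o) => (x.1, dual_map j x.2)) @:
     (linfun (fun x : U1 * 'Hom(U2, F^o) => (j x.1, x.2)) @^-1: E))%VS.

Lemma mem_restrictionP (E : {vspace U2 * 'Hom(U2, F^o)}) x :
  reflect (exists2 f, (j x.1, f) \in E & x.2 = dual_map j f)
          (x \in restriction E).
Proof.
have lin1 : linear (fun x : U1 * 'Hom(U2, F^o) => (x.1, dual_map j x.2)).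
  by move=> k [u f] [v g]; rewrite /= linearP.
have lin2 : linear (fun x : U1 * 'Hom(U2, F^o) => (j x.1, x.2)).
  by move=> k [u f] [v g]; rewrite /= linearP.
pose h1 : {linear _ -> _} := HB.pack
  (fun x : U1 * 'Hom(U2, F^o) => (x.1, dual_map j x.2))
  (GRing.isLinear.Build F _ _ *:%R _ lin1).
pose h2 : {linear _ -> _} := HB.pack
  (fun x : U1 * 'Hom(U2, F^o) => (j x.1, x.2))
  (GRing.isLinear.Build F _ _ *:%R _ lin2).
apply: (iffP memv_imgP) => [[[u f]]|[f jfE x2E]].
  by rewrite -memv_preim (lfunE h2) (lfunE h1) /= => jfE ->; exists f.
exists (x.1, f); first by rewrite -memv_preim (lfunE h2).
by rewrite (lfunE h1) /= -x2E; case: (x).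
Qed.


End Pullback.

(* V_C = V (+) iV: the pair (x, y) stands for x + iy. *)
Definition complexification (R : rcfType) (V : vectType R) : Type := (V * V)%type.

Section Complexification.
Variables (R : rcfType) (V : vectType R).
Local Notation VC := (complexification V).
Implicit Types (z : VC).

HB.instance Definition _ := GRing.Zmodule.copy VC (V * V)%type.

Definition cplx_scale (k : R[i]) z : VC :=
  (complex.Re k *: z.1 - complex.Im k *: z.2,
   complex.Re k *: z.2 + complex.Im k *: z.1).

Fact cplx_scaleA k l z : cplx_scale k (cplx_scale l z) = cplx_scale (k * l) z.
Proof.
case: k l z => [a b] [c d] [x y]; rewrite /cplx_scale /=.
by congr pair; rewrite !scalerBr !scalerDr !scalerBl !scalerDl !scalerA ?opprD
  -!addrA; congr (_ + _); rewrite [RHS]addrC -addrA.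
Qed.

Fact cplx_scale1 : left_id 1 cplx_scale.
Proof.
by case=> x y; rewrite /cplx_scale /= !scale1r !scale0r subr0 addr0.
Qed.

Fact cplx_scaleDr : right_distributive cplx_scale +%R.
Proof.
case=> [a b] [x y] [u v]; rewrite /cplx_scale /=.
by congr pair; rewrite /= !scalerDr ?opprD addrACA.
Qed.

Fact cplx_scaleDl z : {morph cplx_scale^~ z : k l / k + l}.
Proof.
case: z => x y [a b] [c d]; rewrite /cplx_scale /=.
by congr pair; rewrite /= !scalerDl ?opprD addrACA.
Qed.

HB.instance Definition _ := GRing.Zmodule_isLmodule.Build R[i] VC
  cplx_scaleA cplx_scale1 cplx_scaleDr cplx_scaleDl.

Lemma cplx_scaleE (k : R[i]) z : k *: z =
  (complex.Re k *: z.1 - complex.Im k *: z.2,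
   complex.Re k *: z.2 + complex.Im k *: z.1).
Proof. by []. Qed.

Lemma cplx_addE z z' : z + z' = (z.1 + z'.1, z.2 + z'.2).
Proof. by []. Qed.

Fact cplx_vect_axiom : Vector.axiom (\dim {:V}) VC.
Proof.
pose b := vbasis {:V}.
exists (fun z : VC => \row_i (Complex (coord b i z.1) (coord b i z.2))).
  move=> [k l] z z'; apply/rowP => i; rewrite !mxE cplx_addE cplx_scaleE /=.
  rewrite !linearD !linearN !linearZ /=; congr Complex; ring.
exists (fun r : 'rV_(\dim {:V}) => (\sum_i complex.Re (r 0 i) *: b`_i,
                   \sum_i complex.Im (r 0 i) *: b`_i) : VC) => [[x y]|r].
  rewrite [in RHS](coord_vbasis (memvf x)) [in RHS](coord_vbasis (memvf y)).
  by congr pair; apply: eq_bigr => i _; rewrite mxE.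
apply/rowP => i; rewrite mxE /= !coord_sum_free ?(basis_free (vbasisP _)) //.
by case: (r 0 i).
Qed.

HB.instance Definition _ := Lmodule_hasFinDim.Build R[i] VC cplx_vect_axiom.

Definition conjV z : VC := (z.1, - z.2).

Fact conjV_semilinear k z z' : conjV (k *: z + z') = conjc k *: conjV z + conjV z'.
Proof.
case: k => a b; rewrite !cplx_addE !cplx_scaleE /conjV /=.
by congr pair; rewrite ?scalerN ?scaleNr ?opprK // !opprD.
Qed.

(* The conjugate of a functional: fbar (z) is the conjugate of f (zbar). *)
Definition conj_dual (f : 'Hom(VC, R[i]^o)) : 'Hom(VC, R[i]^o) :=
  linfun (fun z => conjc (f (conjV z)) : R[i]^o).

Lemma conj_dualE f z : conj_dual f z = conjc (f (conjV z)).
Proof.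
have lin : linear (fun z => conjc (f (conjV z)) : R[i]^o).
  move=> k x y; rewrite conjV_semilinear linearD linearZ rmorphD /=.
  by rewrite /GRing.scale /= rmorphM /= conjcK.
pose h : {linear _ -> _} := HB.pack (fun z => conjc (f (conjV z)) : R[i]^o)
  (GRing.isLinear.Build R[i] _ _ *:%R _ lin).
exact: (lfunE h).
Qed.

Definition conj_double (x : VC * 'Hom(VC, R[i]^o)) : VC * 'Hom(VC, R[i]^o) :=
  (conjV x.1, conj_dual x.2).

Definition conj_space (E : {vspace VC * 'Hom(VC, R[i]^o)}) :
    {vspace VC * 'Hom(VC, R[i]^o)} :=
  <<[seq conj_double x | x <- vbasis E]>>%VS.

Lemma conj_doubleK : involutive conj_double.
Proof.
case=> z f; congr pair.
  by rewrite /conj_double /conjV /= opprK; case: z.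
apply/lfunP => w; rewrite /= !conj_dualE conjcK.
by rewrite /conjV /= opprK; case: w.
Qed.

Lemma conj_double_semilinear k x y :
  conj_double (k *: x + y) = conjc k *: conj_double x + conj_double y.
Proof.
case: x y => [z f] [z' g]; congr pair; first exact: conjV_semilinear.
apply/lfunP => w; rewrite add_lfunE scale_lfunE !conj_dualE add_lfunE scale_lfunE.
by rewrite rmorphD rmorphM.
Qed.

Fact conj_double_sum (I : finType) (c : I -> R[i])
    (x : I -> VC * 'Hom(VC, R[i]^o)) :
  conj_double (\sum_i c i *: x i) = \sum_i conjc (c i) *: conj_double (x i).
Proof.
apply: (big_ind2 (fun x y => conj_double x = y)) => [|x1 y1 x2 y2 <- <-|i _].
- by have := conj_double_semilinear (-1) 0 0; rewrite scaler0 addr0 rmorphN1 scaleN1r addNr.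
- by have := conj_double_semilinear 1 x1 x2; rewrite rmorph1 !scale1r.
- have := conj_double_semilinear (c i) (x i) 0; rewrite addr0 => ->.
  have := conj_double_semilinear (-1) 0 0.
  by rewrite scaler0 addr0 rmorphN1 scaleN1r addNr => ->; rewrite addr0.
Qed.

Lemma mem_conj_space E x : (x \in conj_space E) = (conj_double x \in E).
Proof.
have sub y : y \in E -> conj_double y \in conj_space E.
  move=> yE; rewrite (coord_vbasis yE) conj_double_sum memv_suml // => i _.
  by apply/memvZ/memv_span/map_f/mem_nth; rewrite size_tuple.
apply/idP/idP => [xE|/sub]; last by rewrite conj_doubleK.
rewrite (coord_span (X := map_tuple conj_double (vbasis E)) xE).
rewrite conj_double_sum memv_suml // => i _; apply: memvZ.
by rewrite (nth_map 0) ?size_tuple // conj_doubleK vbasis_mem // mem_nth // size_tuple.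
Qed.

(* The conjugate-linear ring automorphism of /\ V_C^* extending conj_dual. *)
Definition conj_spinor (phi : ext R[i] (\dim {:VC})) : ext R[i] (\dim {:VC}) :=
  ext_lift (fun i => form1 (conj_dual (dual_basis i))) (ext_map conjc phi).

Lemma conj_spinor_form1 f : conj_spinor (form1 f) = form1 (conj_dual f).
Proof.
have -> : conj_dual f = \sum_(i < \dim {:VC})
    conjc (f (vbasis {:VC})`_i) *: conj_dual (dual_basis i).
  apply/lfunP => z; rewrite conj_dualE {1}(dual_basis_sum f) !sum_lfunE rmorph_sum.
  by apply: eq_bigr => i _; rewrite !scale_lfunE rmorphM conj_dualE.
rewrite linear_sum /conj_spinor.
have -> : ext_map conjc (form1 f) = \sum_(i < \dim {:VC})
    conjc (f (vbasis {:VC})`_i) *: ext_var R[i] i.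
  apply/ffunP => S; rewrite ffunE !sum_ffunE rmorph_sum.
  by apply: eq_bigr => i _; rewrite !ext_scaleE rmorphM ffunE rmorph_nat.
by rewrite linear_sum; apply: eq_bigr => i _; rewrite !linearZ /= ext_lift_var.
Qed.

Lemma conj_spinor_mul : {morph conj_spinor : a b / a * b}.
Proof.
move=> a b; rewrite /conj_spinor ext_map_mul.
by apply: ext_lift_mul => *; [apply: form1K | apply: form1C].
Qed.

Lemma conj_spinor_semilinear (k : R[i]) a b :
  conj_spinor (k *: a + b) = conjc k *: conj_spinor a + conj_spinor b.
Proof.
rewrite /conj_spinor -linearP; congr ext_lift; apply/ffunP => S.
by rewrite !ffunE rmorphD rmorphM.
Qed.

Definition gc_structure (E : {vspace VC * 'Hom(VC, R[i]^o)}) : Prop :=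
  maximally_isotropic E /\ (E :&: conj_space E = 0)%VS.

End Complexification.

Definition cplx_map (R : rcfType) (U V : vectType R) (h : 'Hom(U, V)) :
    'Hom(complexification U, complexification V) :=
  linfun (fun z : complexification U => (h z.1, h z.2) : complexification V).

Lemma cplx_mapE (R : rcfType) (U V : vectType R) (h : 'Hom(U, V)) z :
  cplx_map h z = (h z.1, h z.2).
Proof.
have lin : linear (fun z : complexification U => (h z.1, h z.2) : complexification V).
  move=> k x y; rewrite !cplx_addE !cplx_scaleE /=.
  by congr pair; rewrite !linearD ?linearN !linearZ.
pose l : {linear _ -> _} := HB.pack
  (fun z : complexification U => (h z.1, h z.2) : complexification V)
  (GRing.isLinear.Build R[i] _ _ *:%R _ lin).
exact: (lfunE l).
Qed.

Section Subspaces.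
Variables (R : rcfType) (V : vectType R) (W : {vspace V}).
Local Notation VC := (complexification V).
Local Notation WC := (complexification (subvs_of W)).

(* W_C is not literally a subspace of V_C but is embedded in it by this map. *)
Definition inclusion : 'Hom(WC, VC) :=
  cplx_map (linfun (vsval : subvs_of W -> V)).

Definition gc_restriction (E : {vspace VC * 'Hom(VC, R[i]^o)}) :
    {vspace WC * 'Hom(WC, R[i]^o)} := restriction inclusion E.

Definition gc_subspace (E : {vspace VC * 'Hom(VC, R[i]^o)}) : Prop :=
  (gc_restriction E :&: conj_space (gc_restriction E) = 0)%VS.

End Subspaces.

(* Main.v *)
(* On spinors exp(u) /\ f_1 /\ ... /\ f_k with u of degree 2, conjugating the
   Clifford action by exp(u) gives
     (v, g) . (exp(u) P) = exp(u) (iota_v P + (g + iota_v u) P),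
   so the annihilator consists of the (v, g) with f_i(v) = 0 for all i and
   g + iota_v u in the span of the f_i.  A maximally isotropic E has this shape:
   the f_i form a basis of Ann(rho E) and -u extends the skew form on rho E whose
   graph is E modulo Ann(rho E).  Since j^* maps Ann(rho E) onto
   Ann(j^-1(rho E)) with kernel Ann(rho E + im j), the f_i can be chosen adapted
   to W, and contraction commutes with j^*, which gives the spinor of E_W.

   Clifford elements are self-adjoint for the Mukai pairing.  If a nonzero x
   annihilates both phi_1 and phi_2, choose y with xy + yx a nonzero scalar c: then
   c <phi_1, phi_2> = <x y phi_1, phi_2> = <y phi_1, x phi_2> = 0.  If conversely
   E_1 and E_2 meet in 0, they span everything; moving the factors in E_1 to the
   right and those in E_2 to the left shows that <phi_1, phi_2> = 0 would force
   <a phi_1, phi_2> = 0 for every Clifford word a, against irreducibility. *)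
From HB Require Import structures.
Require Import Defs.
From mathcomp Require Import all_boot all_order all_algebra.
From mathcomp Require Import complex reals.
Import GRing.Theory.
Local Open Scope ring_scope.

(** * Induction over products of generators *)

Section Induction.
Set Implicit Arguments.
Unset Strict Implicit.
Variables (F : comNzRingType) (n : nat).
Local Notation e := (@ext_var F n).

(** [ext_basis_min] splits the least index off a basis element, so left multiplication by single
    generators reaches all of them. Zero arises as [-1 *: 1 + 1]. *)
Lemma ext_ind (P : ext F n -> Prop) :
    (forall k a b, P a -> P b -> P (k *: a + b)) -> P 1 ->
    (forall i a, P a -> P (e i * a)) ->
  forall a, P a.
Proof.
move=> Plin P1 PM a.
have P0 : P 0 by rewrite -(addNr 1) -scaleN1r; apply: Plin.
rewrite (ext_sum_basis a); apply: (big_ind P) => // [b c Pb Pc|S _].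
  by rewrite -[b]scale1r; apply: Plin.
rewrite -[_ *: _]addr0; apply: Plin => //.
have [k] := ubnP #|S|; elim: k S => // k IHk S.
have [-> //|/(ext_basis_min F)[i iS ->] leSk] := eqVneq S set0.
by apply/PM/IHk; move: leSk; rewrite (cardsD1 i) iS.
Qed.

End Induction.

(** * Grading, elements of degree two, contraction, reversal and the exponential *)

Section ExteriorAlgebra.
Set Implicit Arguments.
Unset Strict Implicit.
Variables (F : fieldType) (n : nat).
Implicit Types (a b u : ext F n) (S : {set 'I_n}) (v w : 'I_n -> F).
Local Notation e := (@ext_var F n).

Lemma ext_homogeneousP d a :
  ext_homogeneous d a <-> forall S, #|S| != d -> a S = 0.
Proof.
split=> [<- S /negPf nS|a0]; first by rewrite ffunE nS.
by apply/ffunP => S; rewrite ffunE; case: eqP => // /eqP/a0.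
Qed.

Lemma ext_scalar_inj : injective (fun k : F => k *: 1 : ext F n).
Proof.
move=> k l /(congr1 (fun a : ext F n => a set0)) /=.
by rewrite !ext_scaleE ffunE eqxx !mulr1.
Qed.

Lemma ext_homogeneous_lin d k a b : ext_homogeneous d a -> ext_homogeneous d b ->
  ext_homogeneous d (k *: a + b).
Proof.
move=> /ext_homogeneousP a0 /ext_homogeneousP b0; apply/ext_homogeneousP => S nS.
by rewrite ext_addE ext_scaleE a0 ?b0 // mulr0 addr0.
Qed.

Lemma ext_homogeneous_sum d (I : finType) (a : I -> ext F n) :
  (forall i, ext_homogeneous d (a i)) -> ext_homogeneous d (\sum_i a i).
Proof.
move=> ha; apply/ext_homogeneousP => S nS; rewrite sum_ffunE big1 // => i _.
by rewrite ((ext_homogeneousP _ _).1 (ha i)).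
Qed.

Lemma ext_homogeneous_mul c d a b : ext_homogeneous c a -> ext_homogeneous d b ->
  ext_homogeneous (c + d) (a * b).
Proof.
move=> /ext_homogeneousP a0 /ext_homogeneousP b0; apply/ext_homogeneousP => S nS.
rewrite ext_mulE big1 // => T sTS; have [cT|/a0->] := eqVneq #|T| c; last first.
  by rewrite mul0r mulr0.
rewrite b0 ?mulr0 //; apply: contraNneq nS => cST.
by rewrite -cT -cST cardsD (setIidPr sTS) subnKC // subset_leq_card.
Qed.

Lemma ext_homogeneous1 : @ext_homogeneous F n 0 1.
Proof.
apply/ext_homogeneousP => S; rewrite cards_eq0 ffunE.
by case: (S == set0).
Qed.

Lemma ext_homogeneous_var i : @ext_homogeneous F n 1 (e i).
Proof.
apply/ext_homogeneousP => S; rewrite ffunE.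
by case: (S =P _) => // ->; rewrite cards1.
Qed.

Lemma ext_homogeneous_exp d k a :
  ext_homogeneous d a -> ext_homogeneous (k * d) (a ^+ k).
Proof.
move=> ha; elim: k => [|k IHk]; first exact: ext_homogeneous1.
by rewrite exprS mulSn; apply: ext_homogeneous_mul.
Qed.

Lemma ext_homogeneous_gt d a : (n < d)%N -> ext_homogeneous d a -> a = 0.
Proof.
move=> lt_nd /ext_homogeneousP a0; apply/ffunP => S; rewrite a0 ?ffunE //.
by rewrite neq_ltn (leq_ltn_trans _ lt_nd) // -[leqRHS]card_ord max_card.
Qed.

Lemma homogeneous2_ind (P : ext F n -> Prop) : P 0 ->
    (forall k a b, P a -> P b -> P (k *: a + b)) ->
    (forall i j, P (e i * e j)) ->
  forall u, ext_homogeneous 2 u -> P u.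
Proof.
move=> P0 Plin PM u /ext_homogeneousP u0; rewrite (ext_sum_basis u).
apply: (big_ind P) => // [b c Pb Pc|S _].
  by rewrite -[b]scale1r; apply: Plin.
have [cS|/u0->] := eqVneq #|S| 2; last by rewrite scale0r.
rewrite -[_ *: _]addr0; apply: Plin => //.
have nS : S != set0 by rewrite -cards_eq0 cS.
have [i iS ->] := ext_basis_min F nS.
have /eqP/cards1P[j ->] : #|S :\ i| = 1.
  by move: cS; rewrite (cardsD1 i) iS => -[].
exact: PM.
Qed.

(** A generator passes [e i * e j] with two sign changes. *)
Lemma homogeneous2_comm u a : ext_homogeneous 2 u -> u * a = a * u.
Proof.
move: u; apply: homogeneous2_ind => [|k b c Cb Cc|i j].
- by rewrite mulr0 mul0r.
- by rewrite mulrDl mulrDr Cc -scalerAl Cb scalerAr.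
move: a; apply: ext_ind => [k b c Cb Cc||l b Cb].
- by rewrite mulrDl mulrDr Cc -scalerAl -Cb scalerAr.
- by rewrite mulr1 mul1r.
rewrite -[RHS]mulrA -Cb !mulrA; congr (_ * b).
by rewrite -mulrA [e j * _]ext_varC mulrN mulrA [e i * e l]ext_varC mulNr opprK.
Qed.

Lemma homogeneous2_contract v u a : ext_homogeneous 2 u ->
  ext_contract v (u * a) = ext_contract v u * a + u * ext_contract v a.
Proof.
move: u; apply: homogeneous2_ind => [|k b c Db Dc|i j].
- by rewrite linear0 !mul0r linear0 addr0.
- rewrite mulrDl -scalerAl !ext_contract_is_linear Db Dc !mulrDl -!scalerAl.
  by rewrite scalerDr addrACA.
have De b : ext_contract v (e i * e j * b) =
    (v i *: e j - v j *: e i) * b + e i * e j * ext_contract v b.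
  rewrite -mulrA !ext_contract_var mulrBr -!scalerAr opprB addrA addrAC.
  by rewrite mulrBl -!scalerAl -!mulrA.
rewrite De; congr (_ * a + _).
(* The case [b = 1] identifies the bracket in [De] with the contraction of [e i * e j]. *)
by have:= De 1; rewrite !mulr1 ext_contract_basis0 mulr0 addr0 => ->.
Qed.

Lemma ext_contractC v w a :
  ext_contract v (ext_contract w a) = - ext_contract w (ext_contract v a).
Proof.
move: a; apply: ext_ind => [k a b Ca Cb||i a Ca].
- by rewrite !ext_contract_is_linear Ca Cb scalerN opprD.
- by rewrite !ext_contract_basis0 !linear0.
rewrite !ext_contract_var !linearB !linearZ /= !ext_contract_var Ca mulrN.
by rewrite !opprB scalerN addrA addrC.
Qed.

Lemma ext_rev_linear : linear (@ext_rev F n).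
Proof.
move=> k a b; apply/ffunP => S; rewrite ext_addE ext_scaleE !ffunE.
by rewrite mulrDr /GRing.scale /= mulrCA.
Qed.

Lemma ext_rev0 : ext_rev (0 : ext F n) = 0.
Proof. by apply/ffunP => S; rewrite !ffunE mulr0. Qed.

Lemma ext_rev1 : ext_rev (1 : ext F n) = 1.
Proof.
apply/ffunP => S; rewrite !ffunE; case: eqP => [->|]; rewrite ?mulr0 //.
by rewrite cards0 mul1r.
Qed.

Lemma ext_contract_setT v a : ext_contract v a [set: 'I_n] = 0.
Proof. by rewrite ffunE big1 // => i; rewrite inE. Qed.

(** Induction on [a]. At [1] both sides vanish, since a contraction has no top coefficient; for
    [e i * a] the hypothesis is applied to [e i * b], and the two terms with factor [v i] cancel. *)
Lemma ext_rev_contract v a b :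
  (ext_rev (ext_contract v a) * b) [set: 'I_n] =
  (ext_rev a * ext_contract v b) [set: 'I_n].
Proof.
elim/ext_ind: a b => [k a c Ia Ic||i a Ia] b.
- rewrite ext_contract_is_linear !ext_rev_linear !mulrDl -!scalerAl.
  by rewrite !ext_addE !ext_scaleE Ia Ic.
- rewrite ext_contract_basis0 ext_rev1 mul1r ext_contract_setT.
  by rewrite ext_rev0 mul0r ffunE.
rewrite ext_contract_var ext_rev_mul ext_rev_var.
have -> : ext_rev (v i *: a - e i * ext_contract v a) =
    v i *: ext_rev a - ext_rev (ext_contract v a) * e i.
  rewrite ext_rev_linear -scaleN1r -[-1 *: _]addr0 ext_rev_linear ext_rev0.
  by rewrite addr0 scaleN1r ext_rev_mul ext_rev_var.
rewrite mulrBl -[ext_rev (ext_contract _ _) * _ * b]mulrA -scalerAl.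
rewrite ext_addE ext_oppE ext_scaleE Ia ext_contract_var.
rewrite mulrBr -scalerAr ext_addE ext_oppE ext_scaleE opprB addrC subrK.
by rewrite mulrA.
Qed.

Section Exponential.
Hypothesis char0 : [pchar F] =i pred0.
Variables (u : ext F n).
Hypothesis hu : ext_homogeneous 2 u.

Lemma homogeneous2_nilpotent : u ^+ n.+1 = 0.
Proof.
apply: (@ext_homogeneous_gt (n.+1 * 2)%N); first exact: leq_pmulr.
exact: ext_homogeneous_exp.
Qed.

(** Leibniz rule for the central element [u]. At [k = 0] the coefficient [k%:R] is zero, so the
    value of [k.-1] there is harmless. *)
Lemma homogeneous2_contract_exp v k a : ext_contract v (u ^+ k * a) =
  k%:R *: (u ^+ k.-1 * (ext_contract v u * a)) + u ^+ k * ext_contract v a.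
Proof.
elim: k => [|k IHk]; first by rewrite expr0 !mul1r scale0r add0r.
rewrite exprS -!mulrA homogeneous2_contract // IHk mulrDr addrA /=.
congr (_ + _).
have -> : ext_contract v u * (u ^+ k * a) = u ^+ k * (ext_contract v u * a).
  rewrite !mulrA; congr (_ * a); apply: commrX.
  exact/esym/homogeneous2_comm.
case: k {IHk} => [|k] /=; first by rewrite scale0r mulr0 addr0 scale1r.
rewrite -scalerAr [u * (_ * _)]mulrA -exprS -[X in X + _]scale1r -scalerDl.
by rewrite nat1r.
Qed.

Lemma ext_exp_contract v a :
  ext_contract v (ext_exp u * a) =
  ext_exp u * (ext_contract v u * a + ext_contract v a).
Proof.
(* The right-hand side has a last term in [u ^+ n * ext_contract v u] that differentiating the
   truncated series does not produce. Contracting [u ^+ n.+1 = 0] shows that it vanishes, as [n.+1]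
   is invertible. *)
have un v' : u ^+ n * ext_contract v' u = 0.
  have:= homogeneous2_contract_exp v' n.+1 1.
  rewrite homogeneous2_nilpotent !mul0r linear0 addr0 mulr1 /= => /esym/eqP.
  by rewrite scaler_eq0 ((pcharf0P F).1 char0) => /eqP.
rewrite /ext_exp mulrDr !mulr_suml linear_sum /=.
under eq_bigr => k _ do
  rewrite -scalerAl linearZ /= homogeneous2_contract_exp scalerDr.
rewrite big_split /=; congr (_ + _); last first.
  by apply: eq_bigr => k _; rewrite -scalerAl.
rewrite big_ord_recl scale0r scaler0 add0r [RHS]big_ord_recr /=.
rewrite -scalerAl mulrA un mul0r scaler0 addr0; apply: eq_bigr => k _.
rewrite -scalerAl scalerA /bump /= add1n factS natrM invfM mulrAC mulVf ?mul1r //.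
by rewrite ((pcharf0P F).1 char0).
Qed.

Lemma ext_exp_comm a : ext_exp u * a = a * ext_exp u.
Proof.
rewrite /ext_exp mulr_suml mulr_sumr; apply: eq_bigr => k _.
rewrite -scalerAl -scalerAr; congr (_ *: _); apply/commr_sym/commrX.
exact/esym/homogeneous2_comm.
Qed.

(** Since [ext_exp u = 1 + u * r], the hypothesis reads [a = - (u * r) * a]; iterating it [n.+1]
    times brings in [u ^+ n.+1 = 0]. *)
Lemma ext_exp_lreg a : ext_exp u * a = 0 -> a = 0.
Proof.
pose r : ext F n := \sum_(k < n) (k.+1`!%:R)^-1 *: u ^+ k.
have -> : ext_exp u = 1 + u * r.
  rewrite /ext_exp big_ord_recl fact0 invr1 scale1r; congr (_ + _).
  by rewrite mulr_sumr; apply: eq_bigr => k _; rewrite -scalerAr -exprS.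
rewrite mulrDl mul1r => /eqP; rewrite addr_eq0 => /eqP aE.
have {}aE k : a = (- (u * r)) ^+ k * a.
  by elim: k => [|k IHk]; rewrite ?mul1r // exprSr -mulrA mulNr -aE.
rewrite (aE n.+1) exprNn exprMn_comm; last exact: homogeneous2_comm.
by rewrite homogeneous2_nilpotent mul0r mulr0 mul0r.
Qed.

End Exponential.
End ExteriorAlgebra.

(** * Separation by functionals and vectors, and linear sections *)

Section Duality.
Set Implicit Arguments.
Unset Strict Implicit.
Variable F : fieldType.

(** The map [p] has kernel [X]; [h] is a coordinate of [p] that is nonzero at [x], normalised. *)
Lemma separating_functional (T : vectType F) (X : {vspace T}) x :
  x \notin X ->
  exists2 h : 'Hom(T, F^o), h x = 1 & forall y, y \in X -> h y = 0.
Proof.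
move=> nXx; have [p pE] : exists p : 'End(T), forall y, p y = y - projv X y.
  by exists (\1 - projv X)%VF => y; rewrite add_lfunE opp_lfunE id_lfunE.
have px0 : p x != 0.
  by rewrite pE subr_eq0; apply: contraNneq nXx => ->; apply: memv_proj.
have [i ci0] : exists i, coord (vbasis {:T}) i (p x) != 0.
  apply/existsP; apply: contraR px0 => /existsPn c0.
  rewrite (coord_vbasis (memvf (p x))) big1 // => i _.
  by have /negPn/eqP-> := c0 i; rewrite scale0r.
pose ci : 'Hom(T, F^o) := linfun (coord (vbasis {:T}) i : T -> F^o).
have ciE y : ci y = coord (vbasis {:T}) i y by rewrite lfunE.
exists ((coord (vbasis {:T}) i (p x))^-1 *: (ci \o p)%VF) => [|y Xy].
  by rewrite scale_lfunE comp_lfunE /= ciE; apply: mulVf.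
by rewrite scale_lfunE comp_lfunE /= (pE y) projv_id // subrr linear0 scaler0.
Qed.

(** Reflexivity: a functional [L] on the dual space is evaluation at the vector with coordinates
    [L (dual_basis i)]. *)
Lemma separating_vector (U : vectType F) (X : {vspace 'Hom(U, F^o)}) h :
  h \notin X -> exists2 v, h v = 1 & forall f, f \in X -> f v = 0.
Proof.
case/separating_functional => L Lh LX.
exists (\sum_(i < \dim {:U}) L (dual_basis i) *: (vbasis {:U})`_i).
  rewrite -Lh [in RHS](dual_basis_sum h) !linear_sum; apply: eq_bigr => i _.
  by rewrite !linearZ; apply: mulrC.
move=> f /LX; rewrite [in L f](dual_basis_sum f) !linear_sum => LX0.
rewrite -[RHS]LX0; apply: eq_bigr => i _.
by rewrite !linearZ; apply: mulrC.
Qed.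

Lemma lfun_section (T1 T2 : vectType F) (h : 'Hom(T1, T2)) (X : {vspace T1}) :
  exists s : 'Hom(T2, T1),
    forall y, y \in (h @: X)%VS -> s y \in X /\ h (s y) = y.
Proof.
(* The value at [y] is the projection to [X] of a preimage under [h \o projv X]: it lies in [X], and
   [h] sends it to [y]. *)
exists (projv X \o (h \o projv X)^-1)%VF => y /memv_imgP[x Xx yE].
rewrite comp_lfunE /=; split; first exact: memv_proj.
rewrite -[h _]comp_lfunE limg_lfunVK // yE -{1}(projv_id Xx) -comp_lfunE.
exact/memv_img/memvf.
Qed.

End Duality.

(** * The Clifford action and the annihilators of pure spinors *)

Section Clifford.
Set Implicit Arguments.
Unset Strict Implicit.
Variables (F : fieldType) (U : vectType F).
Implicit Types (f g h : 'Hom(U, F^o)) (v w : U) (x y : U * 'Hom(U, F^o)).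
Implicit Types (E : {vspace U * 'Hom(U, F^o)}) (phi psi : ext F (\dim {:U})).
Implicit Types (fs : seq 'Hom(U, F^o)).

Lemma contraction_linear v : linear (@contraction F U v).
Proof. exact: ext_contract_is_linear. Qed.

Lemma contractionD v phi psi :
  contraction v (phi + psi) = contraction v phi + contraction v psi.
Proof. exact: linearD. Qed.

Lemma contraction_linearl phi k v w :
  contraction (k *: v + w) phi = k *: contraction v phi + contraction w phi.
Proof.
apply/ffunP => S; rewrite ext_addE ext_scaleE !ext_contractE mulr_sumr -big_split.
by apply: eq_bigr => i _; rewrite linearP mulrDl mulrDr -mulrA [RHS]/= mulrCA.
Qed.

Lemma contraction0l phi : contraction 0 phi = 0.
Proof.
have := contraction_linearl phi (-1) 0 0.
by rewrite scaler0 addr0 scaleN1r addNr.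
Qed.

Lemma clifford_linear x : linear (clifford x).
Proof.
move=> k a b; rewrite /clifford contraction_linear mulrDr -scalerAr.
by rewrite scalerDr addrACA.
Qed.

Lemma clifford0 x : clifford x 0 = 0.
Proof. by have:= clifford_linear x (-1) 0 0; rewrite scaler0 addr0 scaleN1r addNr. Qed.

Lemma cliffordD x y phi : clifford (x + y) phi = clifford x phi + clifford y phi.
Proof.
rewrite /clifford [form1 _]linearD mulrDl addrACA; congr (_ + _).
by have := contraction_linearl phi 1 x.1 y.1; rewrite !scale1r.
Qed.

(** The Clifford relation; its scalar is [pairing] without the factor -1/2. Double contractions and
    products of one-forms anticommute, and the mixed terms [K] cancel. *)
Lemma cliffordC x y phi : clifford x (clifford y phi) =
  (x.2 y.1 + y.2 x.1) *: phi - clifford y (clifford x phi).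
Proof.
have cE (z w : U * 'Hom(U, F^o)) : clifford z (clifford w phi) =
    contraction z.1 (contraction w.1 phi) + (w.2 z.1) *: phi +
    (form1 z.2 * contraction w.1 phi - form1 w.2 * contraction z.1 phi) +
    form1 z.2 * form1 w.2 * phi.
  rewrite /clifford contractionD contraction_form1 mulrDr mulrA !addrA; congr (_ + _).
  by rewrite -!addrA [- _ + _]addrC.
rewrite !cE form1C mulNr /contraction ext_contractC -!/(contraction _ _).
rewrite -[form1 y.2 * _ - _]opprB; set K := form1 x.2 * _ - _.
apply/eqP; rewrite scalerDl eq_sym subr_eq addrACA addNr addr0 addrACA subrr addr0.
by rewrite addrACA addNr add0r addrC.
Qed.

(** Only the full index set has top degree, so later arguments can follow a single scalar through
    Clifford words. *)
Lemma mukai_eq0 phi psi :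
  mukai phi psi = 0 <-> (ext_rev phi * psi) [set: 'I_(\dim {:U})] = 0.
Proof.
split=> [/ffunP/(_ setT)|m0]; first by rewrite !ffunE cardsT card_ord eqxx.
apply/ffunP => S; rewrite !ffunE; case: eqP => // cS.
suff -> : S = setT by rewrite -ext_mulE.
by apply/eqP; rewrite eqEcard subsetT cardsT card_ord cS /=.
Qed.

Lemma mukai_clifford x phi psi :
  (ext_rev (clifford x phi) * psi) [set: 'I_(\dim {:U})] =
  (ext_rev phi * clifford x psi) [set: 'I_(\dim {:U})].
Proof.
rewrite /clifford -[contraction _ phi]scale1r ext_rev_linear scale1r ext_rev_mul.
rewrite ext_rev_form1 mulrDl mulrDr !ext_addE -mulrA; congr (_ + _).
exact: ext_rev_contract.
Qed.

Lemma contraction_prod0 v fs : (forall f, f \in fs -> f v = 0) ->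
  contraction v (\prod_(f <- fs) form1 f) = 0.
Proof.
elim: fs => [|f fs IHfs] fv0; first by rewrite big_nil contraction1.
rewrite big_cons contraction_form1 fv0 ?mem_head // scale0r sub0r IHfs ?mulr0 ?oppr0 //.
by move=> g gfs; rewrite fv0 // inE gfs orbT.
Qed.

(** Contraction with a vector dual to the head and killed by the tail strips off the head. *)
Lemma prod_form1_neq0 fs : free fs -> \prod_(f <- fs) form1 f != 0.
Proof.
elim: fs => [|f fs IHfs]; first by rewrite big_nil oner_neq0.
rewrite free_cons big_cons => /andP[/separating_vector[v fv1 v0] /IHfs].
apply: contraNneq => ffs0; have := contraction_form1 v f (\prod_(g <- fs) form1 g).
rewrite ffs0 fv1 scale1r contraction_prod0 => [|g gfs]; last exact/v0/memv_span.
by rewrite mulr0 subr0 /contraction linear0 => <-.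
Qed.

Lemma form1_prod0 f fs : f \in <<fs>>%VS -> form1 f * \prod_(g <- fs) form1 g = 0.
Proof.
have fs0 g : g \in fs -> form1 g * \prod_(k <- fs) form1 k = 0.
  elim: fs => // k fs IHfs; rewrite inE big_cons mulrA => /predU1P[->|gfs].
    by rewrite form1K mul0r.
  by rewrite form1C mulNr -mulrA IHfs // mulr0 oppr0.
move=> /(coord_span (X := in_tuple fs))->; rewrite linear_sum mulr_suml.
rewrite big1 // => i _; rewrite linearZ -scalerAl fs0 ?scaler0 //.
exact: mem_nth.
Qed.

Lemma homogeneous2_contraction v u : ext_homogeneous 2 u ->
  exists h, form1 h = contraction v u.
Proof.
move: u; apply: homogeneous2_ind => [|k a b [f fE] [g gE]|i j].
- by exists 0; rewrite /contraction !linear0.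
- by exists (k *: f + g); rewrite form1_is_linear fE gE contraction_linear.
(* The antiderivation rule on [e_i /\ e_j]; the trailing [0] gives both sums the shape expected by
   [form1_is_linear]. *)
exists (coord (vbasis {:U}) i v *: dual_basis j
          + (- coord (vbasis {:U}) j v *: dual_basis i + 0)).
rewrite !form1_is_linear linear0 addr0 !form1_dual_basis /contraction.
rewrite ext_contract_var -[ext_var F j]mulr1 ext_contract_var.
by rewrite ext_contract_basis0 mulr0 subr0 -scalerAr mulr1 scaleNr mulr1.
Qed.

Lemma contraction_form1_scalar v f : contraction v (form1 f) = f v *: 1.
Proof. by rewrite -[form1 f]mulr1 contraction_form1 contraction1 mulr0 subr0. Qed.

Lemma form1_inj : injective (@form1 F U).
Proof.
move=> f g fg; apply/lfunP => v; apply: (@ext_scalar_inj F (\dim {:U})).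
by rewrite -!contraction_form1_scalar fg.
Qed.

(** Contracting [u] by [v] and [w] in the two orders gives opposite scalars. *)
Lemma contraction_form1_skew v w f g u :
  form1 f = contraction v u -> form1 g = contraction w u -> f w = - g v.
Proof.
move=> fE gE; apply: (@ext_scalar_inj F (\dim {:U})).
by rewrite scaleNr -!contraction_form1_scalar fE gE [LHS]ext_contractC.
Qed.

Lemma form1_homogeneous f : ext_homogeneous 1 (form1 f).
Proof.
apply: ext_homogeneous_sum => i; rewrite -[_ *: _]addr0.
apply: ext_homogeneous_lin; first exact: ext_homogeneous_var.
by apply/ffunP => S; rewrite !ffunE if_same.
Qed.

Section PureSpinor.
Hypothesis char0 : [pchar F] =i pred0.
Variables (u : ext F (\dim {:U})) (fs : seq 'Hom(U, F^o)).
Hypothesis hu : ext_homogeneous 2 u.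

Lemma clifford_exp_wedge x h :
    form1 h = contraction x.1 u -> \prod_(f <- fs) form1 f != 0 ->
  clifford x (exp_wedge u fs) = 0 <->
  (forall f, f \in fs -> f x.1 = 0) /\ x.2 + h \in <<fs>>%VS.
Proof.
move=> hE P0; set P := \prod_(f <- fs) form1 f in P0 *.
have -> : clifford x (exp_wedge u fs) =
    ext_exp u * (form1 (x.2 + h) * P + contraction x.1 P).
  rewrite /clifford /exp_wedge -/P [contraction _ _]ext_exp_contract //.
  rewrite -/(contraction _ _) -hE.
  rewrite mulrA -ext_exp_comm // -mulrA -mulrDr [form1 (_ + _)]linearD mulrDl.
  by rewrite addrC addrA.
split=> [/(ext_exp_lreg hu) xP0 | [fx0 hfs]]; last first.
  by rewrite contraction_prod0 // form1_prod0 // addr0 mulr0.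
(* Multiplying [xP0] by [f] removes its first term because [fP0], leaving [f] times the contraction
   of [P] equal to zero. Contracting [fP0] itself shows that this product is [f x.1 *: P]. *)
have fx0 f : f \in fs -> f x.1 = 0.
  move=> ffs; have fP0 : form1 f * P = 0 by apply/form1_prod0/memv_span.
  have := contraction_form1 x.1 f P; rewrite fP0 /contraction linear0.
  move/eqP; rewrite eq_sym subr_eq0 => /eqP fxP.
  have := congr1 (GRing.mul (form1 f)) xP0.
  rewrite mulrDr mulrA form1C mulNr -mulrA fP0 mulr0 oppr0 add0r mulr0.
  by rewrite -fxP => /eqP; rewrite scaler_eq0 (negPf P0) orbF => /eqP.
(* The contraction of [P] by [x.1] is now zero, so [x.2 + h] wedged with [P] vanishes; contraction
   with the separating [v] turns this into [P = 0]. *)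
split=> //; apply/negPn/negP => /separating_vector[v hv v0].
case/eqP: P0; have := contraction_form1 v (x.2 + h) P.
move: xP0; rewrite !contraction_prod0 // => [|f ffs]; last exact/v0/memv_span.
rewrite addr0 => ->; rewrite hv scale1r mulr0 subr0 => <-.
by rewrite /contraction linear0.
Qed.

(** Testing against [(0, f)] for [f] in [fs] gives [f x.1 = 0]; testing against [(w, - k)], where
    [fs] kills [w] and [k] is the contraction of [u] by [w], gives the condition on [x.2]. The Mukai
    criterion takes maximality in this form. *)
Lemma perp_representative E x : representative E (exp_wedge u fs) ->
  (forall y, y \in E -> pairing x y = 0) -> x \in E.
Proof.
case=> phi0 Eann perp.
have P0 : \prod_(f <- fs) form1 f != 0.
  by apply: contraNneq phi0; rewrite /exp_wedge => ->; rewrite mulr0.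
have {}perp y : y \in E -> x.2 y.1 + y.2 x.1 = 0.
  move/perp => /eqP; rewrite mulf_eq0 oppr_eq0 invr_eq0 ((pcharf0P F).1 char0) /=.
  exact: eqP.
have [h hE] := homogeneous2_contraction x.1 hu.
apply/Eann/(clifford_exp_wedge hE P0); split=> [f ffs|].
  have: (0, f) \in E.
    apply/Eann/(clifford_exp_wedge (h := 0)) => //=.
      by rewrite linear0 contraction0l.
    by split=> [g _|]; [rewrite linear0 | rewrite addr0 memv_span].
  by move/perp; rewrite /= linear0 add0r.
apply/negPn/negP => /separating_vector[w hw w0].
have [k kE] := homogeneous2_contraction w hu.
have : (w, - k) \in E.
  apply/Eann/(clifford_exp_wedge (h := k)) => //=.
  rewrite addNr mem0v; split=> // f ffs.
  exact/w0/memv_span.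
move/perp; rewrite /= opp_lfunE -(contraction_form1_skew hE kE) => /eqP.
by rewrite -add_lfunE hw oner_eq0.
Qed.

End PureSpinor.
End Clifford.

(** * The Mukai pairing of two pure spinors *)

Section Mukai.
Set Implicit Arguments.
Unset Strict Implicit.
Variables (F : fieldType) (U : vectType F).
Implicit Types (f g h : 'Hom(U, F^o)) (v w : U) (x y z : U * 'Hom(U, F^o)).
Implicit Types (E : {vspace U * 'Hom(U, F^o)}) (phi psi : ext F (\dim {:U})).
Local Notation clifford_word phi xs := (foldr (@clifford F U) phi xs).
Local Notation top phi := ((phi : {ffun _ -> _}) [set: 'I_(\dim {:U})]).

Lemma functional_pairing (L : 'Hom((U * 'Hom(U, F^o))%type, F^o)) :
  exists z, forall y, L y = z.2 y.1 + y.2 z.1.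
Proof.
have lin1 : linear (fun v => L (v, 0) : F^o).
  move=> k v w; rewrite -linearP; congr (L _).
  by congr pair; rewrite /= scaler0 addr0.
have lin2 : linear (fun f : 'Hom(U, F^o) => L (0, f) : F^o).
  move=> k v w; rewrite -linearP; congr (L _).
  by congr pair; rewrite /= scaler0 addr0.
pose h1 : {linear U -> F^o} := HB.pack (fun v => L (v, 0) : F^o)
  (GRing.isLinear.Build F _ _ *:%R _ lin1).
pose h2 : {linear 'Hom(U, F^o) -> F^o} :=
  HB.pack (fun f : 'Hom(U, F^o) => L (0, f) : F^o)
  (GRing.isLinear.Build F _ _ *:%R _ lin2).
exists (\sum_(i < \dim {:U}) h2 (dual_basis i) *: (vbasis {:U})`_i, linfun h1).
case=> v f /=; have vfE : (v, f) = (v, 0) + (0, f).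
  by congr pair; rewrite /= ?addr0 ?add0r.
rewrite vfE [L _]linearD (lfunE h1); congr (_ + _).
rewrite -[LHS]/(h2 f) [in LHS](dual_basis_sum f) !linear_sum.
by apply: eq_bigr => i _; rewrite !linearZ; apply: mulrC.
Qed.

Lemma pairing_nondegenerate z : (forall y, z.2 y.1 + y.2 z.1 = 0) -> z = 0.
Proof.
case: z => v f /= z0; congr pair; last first.
  by apply/lfunP => w; have:= z0 (w, 0); rewrite /= !zero_lfunE addr0.
apply/eqP; rewrite -memv0; apply/negPn/negP => /separating_functional[h hv _].
by have := z0 (0, h); rewrite /= linear0 add0r hv => /eqP; rewrite oner_eq0.
Qed.

Lemma clifford_word_linear xs : linear (fun phi => clifford_word phi xs).
Proof.
by move=> k a b; elim: xs => //= x xs ->; rewrite clifford_linear.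
Qed.

Lemma clifford_word0 xs : clifford_word 0 xs = 0 :> ext F (\dim {:U}).
Proof. by elim: xs => //= x xs ->; rewrite clifford0. Qed.

(** [m] strictly bounds the degree of [phi]. A nonzero contraction with a basis vector lowers it; if
    all of these vanish, so does every coefficient on a nonempty set, and [phi] is already a
    scalar. *)
Lemma clifford_to_scalar phi : phi != 0 ->
  exists xs, exists2 c, c != 0 & clifford_word phi xs = c *: 1.
Proof.
have [m] : exists m, forall S : {set 'I_(\dim {:U})}, (m <= #|S|)%N -> phi S = 0.
  exists (\dim {:U}).+1 => S; rewrite ltnNge.
  by rewrite -[leqRHS]card_ord max_card.
elim: m phi => [|m IHm] phi phi_m phi0.
  by case/eqP: phi0; apply/ffunP => S; rewrite phi_m // ffunE.
pose d (i : 'I_(\dim {:U})) : U * 'Hom(U, F^o) := ((vbasis {:U})`_i, 0).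
have dE i S : clifford (d i) phi S = if i \in S then 0 else
    (-1) ^+ (\sum_(j in S) (j < i))%N * phi (i |: S).
  rewrite /clifford linear0 mul0r addr0 ext_contractE /=.
  have fb := basis_free (vbasisP {:U}).
  case: ifP => iS.
    rewrite big1 // => k kS; rewrite coord_free //.
    have /negPf nik : i != k by apply: contraNneq kS => <-.
    by rewrite nik mul0r mulr0.
  rewrite (bigD1 i) ?iS //= coord_free // eqxx mul1r [X in _ + X]big1 ?addr0 //.
  move=> k /andP[_ ki].
  by rewrite coord_free // eq_sym (negPf ki) mul0r mulr0.
have [/existsP[i di0]|/existsPn d0] := boolP [exists i, clifford (d i) phi != 0].
  have [|//|xs [c c0 xsE]] := IHm (clifford (d i) phi).
    move=> S leS; rewrite dE; case: ifPn => // iS.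
    by rewrite phi_m ?mulr0 // cardsU1 iS.
  by exists (rcons xs (d i)); exists c => //; rewrite foldr_rcons.
exists [::]; exists (phi set0).
  apply: contraNneq phi0 => phi00; apply/eqP/ffunP => S; rewrite [RHS]ffunE.
  have [->|/set0Pn[i iS]] := eqVneq S set0; first by rewrite phi00.
  have /negPn/eqP/ffunP/(_ (S :\ i)) := d0 i.
  rewrite dE setD11 setD1K // [RHS]ffunE => /eqP.
  by rewrite mulf_eq0 signr_eq0 => /eqP.
apply/ffunP => S; rewrite ext_scaleE ffunE /=.
have [->|/set0Pn[i iS]] := eqVneq S set0; first by rewrite mulr1.
have /negPn/eqP/ffunP/(_ (S :\ i)) := d0 i.
rewrite dE setD11 setD1K // [RHS]ffunE => /eqP.
by rewrite mulf_eq0 signr_eq0 => /eqP->; rewrite mulr0.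
Qed.

(** Serves for a complement [~: S]: wedging with that basis element singles out, in top degree, the
    coefficient of the other spinor at [S]. *)
Lemma clifford_basis S : exists xs, clifford_word 1 xs = ext_basis F S.
Proof.
have [k] := ubnP #|S|; elim: k S => // k IHk S.
have [-> _|/(ext_basis_min F)[i iS ->] leSk] := eqVneq S set0; first by exists [::].
have [|xs xsE] := IHk (S :\ i); first by move: leSk; rewrite (cardsD1 i) iS.
exists ((0, dual_basis i) :: xs) => /=.
by rewrite /clifford contraction0l add0r form1_dual_basis xsE.
Qed.

(* Irreducibility of the spinor module combined with nondegeneracy of the
   Mukai pairing. *)
Lemma mukai_irreducible phi psi : phi != 0 -> psi != 0 ->
  exists xs, top (ext_rev (clifford_word phi xs) * psi) != 0.
Proof.
move=> /clifford_to_scalar[xs [c c0 xsE]] psi0.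
have [S psiS] : exists S, psi S != 0.
  apply/existsP; apply: contraR psi0 => /existsPn psi_0.
  by apply/eqP/ffunP => S; rewrite [RHS]ffunE; apply/eqP/negPn/psi_0.
have [ys ysE] := clifford_basis (~: S).
exists (ys ++ xs); rewrite foldr_cat xsE -[c *: 1]addr0 clifford_word_linear.
rewrite clifford_word0 ysE addr0 ext_mulE (bigD1 (~: S)) ?subsetT //=.
rewrite big1 => [|T /andP[_ nT]].
  rewrite addr0 !ffunE eqxx setTD setCK /GRing.scale /= mulr1.
  by rewrite !mulf_neq0 ?signr_eq0.
by rewrite !ffunE (negPf nT) /GRing.scale /= !(mulr0, mul0r).
Qed.

Section PureSpinors.
Variables (E1 E2 : {vspace U * 'Hom(U, F^o)}) (phi1 phi2 : ext F (\dim {:U})).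
Hypotheses (rep1 : representative E1 phi1) (rep2 : representative E2 phi2).
Hypothesis perp1 : forall x, (forall y, y \in E1 -> pairing x y = 0) -> x \in E1.
Hypothesis perp2 : forall x, (forall y, y \in E2 -> pairing x y = 0) -> x \in E2.

Lemma mukai_capv : mukai phi1 phi2 != 0 -> (E1 :&: E2 = 0)%VS.
Proof.
move=> m0; apply/eqP; rewrite -subv0; apply/subvP => x.
rewrite memv_cap memv0 => /andP[/rep1.2 x1 /rep2.2 x2].
apply/eqP/pairing_nondegenerate => y; apply/eqP; apply: contraR m0 => xy0.
apply/eqP/mukai_eq0.
have := mukai_clifford x (clifford y phi1) phi2.
rewrite x2 mulr0 [RHS]ffunE cliffordC x1 clifford0 subr0.
rewrite -[_ *: phi1]addr0 ext_rev_linear mulrDl -scalerAl ext_addE ext_scaleE.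
rewrite ext_rev0 mul0r [X in _ + X]ffunE addr0 => /eqP.
by rewrite mulf_eq0 (negPf xy0) => /eqP.
Qed.

Lemma capv_mukai : (E1 :&: E2 = 0)%VS -> mukai phi1 phi2 != 0.
Proof.
move=> E120.
(* A functional vanishing on the sum is represented by some [z] orthogonal to both spaces, hence in
   both, hence zero. *)
have E12T : (E1 + E2)%VS = fullv.
  apply/eqP; rewrite eqEsubv subvf; apply/subvP => x _.
  apply/negPn/negP => /separating_functional[L Lx L0].
  have [z LE] := functional_pairing L.
  have z0 E : (E <= E1 + E2)%VS -> forall y, y \in E -> pairing z y = 0.
    by move=> sE y /(subvP sE)/L0; rewrite LE /pairing => ->; rewrite mulr0.
  have : z \in (E1 :&: E2)%VS.
    by rewrite memv_cap perp1 ?perp2 //; apply: z0; rewrite ?addvSl ?addvSr.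
  rewrite E120 memv0 => /eqP z_0; move/eqP: Lx.
  by rewrite LE z_0 /= zero_lfunE linear0 addr0 eq_sym oner_eq0.
apply/eqP => /mukai_eq0 m0.
have [xs /eqP[]] := mukai_irreducible rep1.1 rep2.1.
have [m] := ubnP (size xs); elim: m xs => // m IHm xs sxs.
have topP k a b : top (ext_rev (k *: a + b) * phi2) =
    k * top (ext_rev a * phi2) + top (ext_rev b * phi2).
  by rewrite ext_rev_linear mulrDl -scalerAl ext_addE ext_scaleE.
have top0 : top (ext_rev 0 * phi2) = 0.
  by rewrite ext_rev0 mul0r ffunE.
(* A letter of [E1] moves right until it kills [phi1]. Each swap leaves a scalar multiple of a word
   with two letters fewer, covered by [IHm]. *)
have absorb x ys zs : x \in E1 -> (size zs + size ys < m)%N ->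
    top (ext_rev (clifford_word phi1 (zs ++ x :: ys)) * phi2) = 0.
  move=> /rep1.2 x1; elim: ys zs => [|y ys IHys] zs sz.
    by rewrite foldr_cat /= x1 clifford_word0.
  rewrite foldr_cat /= cliffordC addrC -scaleN1r clifford_word_linear topP.
  rewrite -[_ *: clifford_word _ _]addr0 clifford_word_linear clifford_word0 topP top0.
  rewrite addr0 -foldr_cat IHm ?mulr0 ?addr0; last first.
    by rewrite size_cat; apply: leq_ltn_trans sz; rewrite leq_add2l /=.
  have := IHys (rcons zs y); rewrite cat_rcons foldr_cat => /= ->; rewrite ?mulr0 //.
  by rewrite size_rcons addSnnS.
case: xs sxs => [|x xs] //= sxs.
(* Only the head letter has to be split: its [E1] part is absorbed, and its [E2] part crosses the
   pairing at once and kills [phi2]. *)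
have /memv_addP[a aE1 [b bE2 ->]] : x \in (E1 + E2)%VS by rewrite E12T memvf.
rewrite cliffordD -[clifford a _]scale1r topP mul1r.
rewrite [X in X + _](absorb a xs [::] aE1 sxs) add0r.
rewrite mukai_clifford; move/rep2.2: bE2 => ->.
by rewrite mulr0 ffunE.
Qed.

End PureSpinors.
End Mukai.

(** * Maximally isotropic subspaces as graphs over their projection, and adapted bases *)

Section Existence.
Set Implicit Arguments.
Unset Strict Implicit.
Variables (F : fieldType) (U : vectType F).
Hypothesis char0 : [pchar F] =i pred0.
Implicit Types (f g h : 'Hom(U, F^o)) (v w : U) (x y : U * 'Hom(U, F^o)).
Implicit Types (E : {vspace U * 'Hom(U, F^o)}).

Lemma pairing_eq0 x y : pairing x y = 0 <-> x.2 y.1 + y.2 x.1 = 0.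
Proof.
split=> [/eqP|xy0]; last by rewrite /pairing xy0 mulr0.
by rewrite mulf_eq0 oppr_eq0 invr_eq0 ((pcharf0P F).1 char0) => /eqP.
Qed.

(** If [f] vanishes on [rho E], then [(0, f)] is orthogonal to [E] and to itself, so adjoining its
    line keeps isotropy and maximality applies. *)
Lemma mem_ann_rho E f : maximally_isotropic E ->
  (f \in ann (rho E)) = ((0, f) \in E).
Proof.
move=> [isoE maxE]; apply/idP/idP => [/mem_annP f0|fE]; last first.
  apply/mem_annP => v /mem_rhoP[g vgE].
  by have /pairing_eq0 := isoE _ _ fE vgE; rewrite /= linear0 addr0.
have fv0 x : x \in E -> f x.1 = 0.
  by case: x => v g vgE; apply/f0/mem_rhoP; exists g.
suff <- : (E + <[(0%R, f)]>)%VS = E.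
  exact/(subvP (addvSr _ _))/memv_line.
apply: maxE; last exact: addvSl.
move=> _ _ /memv_addP[a aE [_ /vlineP[c ->] ->]] /memv_addP[b bE [_ /vlineP[d ->] ->]].
have /pairing_eq0 ab0 := isoE _ _ aE bE; apply/pairing_eq0 => /=.
rewrite !scaler0 !addr0 !add_lfunE !scale_lfunE (fv0 _ aE) (fv0 _ bE).
by rewrite !scaler0 !addr0.
Qed.

Lemma homogeneous2_of_skew (b : 'Hom(U, 'Hom(U, F^o))) :
    (forall v w, b v w = - b w v) ->
  exists2 u, ext_homogeneous 2 u & forall v, contraction v u = form1 (b v).
Proof.
move=> b_skew.
pose e (i : 'I_(\dim {:U})) := (vbasis {:U})`_i.
(* Contraction by [v] yields [b v] once from each factor, the second time by skew-symmetry; hence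
   the final factor 1/2. *)
pose u := \sum_i form1 (dual_basis i) * form1 (b (e i)).
have contr_u v : contraction v u = 2%:R *: form1 (b v).
  rewrite [LHS]linear_sum /=.
  under eq_bigr => i _ do rewrite [ext_contract _ _]contraction_form1
    contraction_form1_scalar -scalerAr mulr1 b_skew scaleNr opprK lfunE.
  rewrite big_split scaler_nat mulr2n; congr (_ + _).
    rewrite [in RHS](coord_vbasis (memvf v)) !linear_sum /=; apply: eq_bigr => i _.
    by rewrite [b (_ *: _)]linearZ [form1 (_ *: _)]linearZ.
  rewrite [in RHS](dual_basis_sum (b v)) linear_sum /=; apply: eq_bigr => i _.
  by rewrite [form1 (_ *: _)]linearZ.
exists (2%:R^-1 *: u) => [|v]; last first.
  rewrite [LHS]linearZ /= -/(contraction v u) contr_u scalerA mulVf ?scale1r //.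
  by rewrite ((pcharf0P F).1 char0).
rewrite -[_ *: _]addr0; apply: ext_homogeneous_lin.
  apply: ext_homogeneous_sum => i.
  by apply: (@ext_homogeneous_mul _ _ 1 1); apply: form1_homogeneous.
by apply/ffunP => S; rewrite !ffunE if_same.
Qed.

(* On rho E the form represented by u is minus a linear choice s of covectors
   with (v, s v) in E. *)
Lemma maximally_isotropic_graph E : maximally_isotropic E ->
  exists2 u, ext_homogeneous 2 u & forall x h, form1 h = contraction x.1 u ->
    (x \in E) = (x.1 \in rho E) && (x.2 + h \in ann (rho E)).
Proof.
move=> maxE; pose p := projv (rho E).
have [s' s'E] := lfun_section (linfun fst : 'Hom((U * 'Hom(U, F^o))%type, U)) E.
pose s := (linfun (snd : U * 'Hom(U, F^o) -> 'Hom(U, F^o)) \o s')%VF.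
have sE v : v \in rho E -> (v, s v) \in E.
  move=> /s'E; rewrite lfunE comp_lfunE lfunE.
  by case: (s' v) => w g /= [wgE <-].
have lin_b : linear (fun v => - dual_map p (s (p v))).
  move=> k v w; rewrite [p _]linearP [s _]linearP dual_map_is_linear.
  by rewrite opprD scalerN.
pose b' : {linear U -> 'Hom(U, F^o)} := HB.pack
  (fun v => - dual_map p (s (p v))) (GRing.isLinear.Build F _ _ *:%R _ lin_b).
pose b := linfun b'.
have bE v w : b v w = - s (p v) (p w).
  by rewrite lfunE /= opp_lfunE comp_lfunE.
have [|u hu uE] := @homogeneous2_of_skew b.
  move=> v w; apply/eqP; rewrite -subr_eq0 !bE !opprK -opprD oppr_eq0; apply/eqP.
  have pE z : (p z, s (p z)) \in E by apply/sE/memv_proj.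
  by have /pairing_eq0 := maxE.1 _ _ (pE v) (pE w).
exists u => // -[v g] h /=; rewrite uE => /form1_inj ->.
have [vE|nvE] /= := boolP (v \in rho E); last first.
  by apply: contraNF nvE => vgE; apply/mem_rhoP; exists g.
have sbE : s v + b v \in ann (rho E).
  apply/mem_annP => w wE; rewrite add_lfunE bE !projv_id //.
  exact: subrr.
have -> : g + b v = g - s v + (s v + b v) by rewrite addrA subrK.
rewrite (rpredDr _ sbE) mem_ann_rho //.
rewrite -(rpredDr (0, g - s v) (sE v vE)); congr (_ \in E).
by congr pair; rewrite /= ?add0r ?subrK.
Qed.

(** For the harder inclusion, let [w] separate [g] from the image. Every [f] in [ann X] kills [j w],
    so [j w] lies in [X] and [g w = 0], a contradiction. *)
Lemma dual_map_ann (U1 : vectType F) (j : 'Hom(U1, U)) (X : {vspace U}) :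
  (linfun (dual_map j) @: ann X)%VS = ann (j @^-1: X).
Proof.
apply/eqP; rewrite eqEsubv; apply/andP; split.
  apply/subvP => _ /memv_imgP[f /mem_annP fX ->]; apply/mem_annP => v.
  by rewrite -memv_preim lfunE /= comp_lfunE; apply: fX.
apply/subvP => g /mem_annP gX; apply/negPn/negP => /separating_vector[w gw w0].
have : w \in (j @^-1: X)%VS.
  rewrite -memv_preim; apply/negPn/negP => /separating_functional[f fw fX].
  have : linfun (dual_map j) f \in (linfun (dual_map j) @: ann X)%VS.
    exact/memv_img/mem_annP.
  by rewrite lfunE => /w0/eqP; rewrite comp_lfunE fw oner_eq0.
by move/gX/eqP; rewrite gw oner_eq0.
Qed.

(** Rank-nullity for [dual_map j] on [ann X]: [fs1] lifts a basis of the image, [fs2] is a basis of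
    the kernel [ann (X + limg j)]. The count is then right, and only spanning is left. *)
Lemma adapted_basis (U1 : vectType F) (j : 'Hom(U1, U)) (X : {vspace U}) :
  exists fs1 fs2, [/\ basis_of (ann X) (fs1 ++ fs2),
    basis_of (ann (j @^-1: X)) [seq dual_map j g | g <- fs1]
    & basis_of (ann (X + limg j)) fs2].
Proof.
have [s sX] := lfun_section (linfun (dual_map j)) (ann X).
pose B := vbasis (ann (j @^-1: X)).
have {}sX (g : 'Hom(U1, F^o)) : g \in B -> s g \in ann X /\ dual_map j (s g) = g.
  move=> gB; have [|sg jsg] := sX g; last by split=> //; rewrite lfunE in jsg.
  by rewrite dual_map_ann vbasis_mem.
have KE : (ann X :&: lker (linfun (dual_map j)))%VS = ann (X + limg j).
  apply/eqP; rewrite eqEsubv; apply/andP; split; apply/subvP => f.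
    rewrite memv_cap => /andP[/mem_annP fX]; rewrite memv_ker lfunE => /eqP jf0.
    apply/mem_annP => _ /memv_addP[v vX [_ /memv_imgP[w _ ->] ->]].
    have := congr1 (fun k : 'Hom(U1, F^o) => k w) jf0.
    by rewrite comp_lfunE zero_lfunE linearD /= (fX v vX) add0r.
  move=> /mem_annP f0; rewrite memv_cap; apply/andP; split.
    by apply/mem_annP => v vX; apply/f0/(subvP (addvSl _ _)).
  rewrite memv_ker lfunE; apply/eqP/lfunP => w; rewrite comp_lfunE zero_lfunE.
  by apply/f0/(subvP (addvSr _ _))/memv_img/memvf.
have mapE : [seq dual_map j k | k <- [seq s k | k <- B]] = B.
  rewrite -map_comp -[RHS]map_id; apply/eq_in_map => g /sX[_ /=]; exact.
exists [seq s k | k <- B], (vbasis (ann (X + limg j))).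
split; last exact: vbasisP; last by rewrite mapE; apply: vbasisP.
rewrite basisEdim; apply/andP; split; last first.
  by rewrite size_cat size_map !size_tuple -KE -dual_map_ann addnC limg_ker_dim.
apply/subvP => g gX; rewrite span_cat.
(* Past the end of [B] the default entry is [0], for which both claims hold. *)
have sB i : s B`_i \in ann X /\ dual_map j (s B`_i) = B`_i.
  have [/(mem_nth 0)/sX //|leBi] := ltnP i (size B).
  by rewrite nth_default // !linear0 mem0v.
have : dual_map j g \in <<B>>%VS.
  rewrite (span_basis (vbasisP _)); apply/mem_annP => v.
  by rewrite -memv_preim comp_lfunE; move/mem_annP: gX; apply.
(* [g1] is the combination of the lifts with the same pullback as [g], so [g - g1] lies in the
   kernel. *)
move=> /coord_span jgE; pose g1 := \sum_i coord B i (dual_map j g) *: s B`_i.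
have jg1 : dual_map j g1 = dual_map j g.
  rewrite [RHS]jgE linear_sum; apply: eq_bigr => i _ /=.
  by rewrite [dual_map _ _]linearZ /= (sB i).2.
rewrite -(subrKC g1 g); apply: memv_add.
  apply: memv_suml => i _; apply/memvZ/memv_span/map_f/mem_nth.
  by rewrite size_tuple.
rewrite (span_basis (vbasisP _)) -KE memv_cap; apply/andP; split.
  by apply: memvB => //; apply: memv_suml => i _; apply/memvZ; case: (sB i).
rewrite memv_ker lfunE /= addrC -scaleN1r dual_map_is_linear jg1.
by rewrite scaleN1r addNr.
Qed.

End Existence.

(** * Adapted spinors and their pullback *)

Section Restriction.
Set Implicit Arguments.
Unset Strict Implicit.
Variables (F : fieldType) (U1 U2 : vectType F) (j : 'Hom(U1, U2)).
Hypothesis char0 : [pchar F] =i pred0.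
Implicit Types (E : {vspace U2 * 'Hom(U2, F^o)}) (u : ext F (\dim {:U2})).
Implicit Types (f g h : 'Hom(U2, F^o)) (fs : seq 'Hom(U2, F^o)).

Lemma exists_adapted_spinor E : maximally_isotropic E ->
  exists u fs1 fs2, [/\ ext_homogeneous 2 u,
    representative E (exp_wedge u (fs1 ++ fs2)),
    basis_of (ann (j @^-1: rho E)) [seq dual_map j g | g <- fs1]
    & basis_of (ann (rho E + limg j)) fs2].
Proof.
move=> /(maximally_isotropic_graph char0)[u hu uE].
have [fs1 [fs2 [Bfs B1 B2]]] := adapted_basis j (rho E).
exists u, fs1, fs2; split=> //; split.
  by apply: contraNneq (prod_form1_neq0 (basis_free Bfs)) => /(ext_exp_lreg hu)->.
move=> x; have [h hE] := homogeneous2_contraction x.1 hu.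
rewrite (uE _ _ hE) (clifford_exp_wedge char0 hu hE); last first.
  exact: prod_form1_neq0 (basis_free Bfs).
rewrite (span_basis Bfs); split=> [[x0 ->]|/andP[xE ->]].
  (* If [x.1] were outside [rho E], a separating [f] would lie in [ann (rho E)], the span of the
     chosen covectors, all of which kill [x.1]. *)
  rewrite andbT; apply/negPn/negP => /separating_functional[f fx fE].
  have : f \in <<fs1 ++ fs2>>%VS by rewrite (span_basis Bfs); apply/mem_annP.
  move=> /(coord_span (X := in_tuple _)) fsE; move/eqP: fx.
  rewrite fsE sum_lfunE big1 ?(eq_sym 0) ?oner_eq0 // => i _.
  by rewrite scale_lfunE x0 ?scaler0 // mem_nth.
split=> // f /(basis_mem Bfs)/mem_annP; exact.
Qed.

Lemma pullback_linear : linear (pullback j).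
Proof. exact: linearP. Qed.

Lemma pullback_var i : pullback j (ext_var F i) = form1 (dual_map j (dual_basis i)).
Proof. by rewrite -form1_dual_basis pullback_form1. Qed.

Lemma contraction_pullback w a :
  contraction w (pullback j a) = pullback j (contraction (j w) a).
Proof.
move: a; apply: ext_ind => [k a b Ia Ib||i a Ia].
- by rewrite !(pullback_linear, contraction_linear) Ia Ib.
- by rewrite pullback1 !contraction1 [RHS]linear0.
rewrite pullback_mul pullback_var contraction_form1 Ia -form1_dual_basis.
rewrite contraction_form1 comp_lfunE -pullback_form1 -pullback_mul.
by rewrite [RHS]linearB /=; congr (_ - _); rewrite [RHS]linearZ.
Qed.

Lemma pullback_homogeneous2 u : ext_homogeneous 2 u -> ext_homogeneous 2 (pullback j u).
Proof.
have h0 : ext_homogeneous 2 (0 : ext F (\dim {:U1})).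
  by apply/ffunP => S; rewrite !ffunE if_same.
move: u; apply: homogeneous2_ind => [|k a b ha hb|i l].
- by rewrite [pullback j 0]linear0.
- by rewrite pullback_linear; apply: ext_homogeneous_lin.
rewrite pullback_mul !pullback_var.
by apply: (@ext_homogeneous_mul _ _ 1 1); apply: form1_homogeneous.
Qed.

Lemma dual_mapD f g : dual_map j (f + g) = dual_map j f + dual_map j g.
Proof. by have := dual_map_is_linear j 1 f g; rewrite !scale1r. Qed.

Lemma limg_dual_map_span fs :
  (linfun (dual_map j) @: <<fs>>)%VS = <<[seq dual_map j g | g <- fs]>>%VS.
Proof. by rewrite limg_span; congr span; apply: eq_map => g; rewrite lfunE. Qed.

(** [clifford_exp_wedge] describes both annihilators. The covectors in [fs2] vanish at every [j w]
    and have zero pullback, so they affect neither condition downstairs. *)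
Lemma representative_restriction E u fs1 fs2 :
    ext_homogeneous 2 u -> representative E (exp_wedge u (fs1 ++ fs2)) ->
    free [seq dual_map j g | g <- fs1] -> {in fs2, forall f, dual_map j f = 0} ->
  representative (restriction j E)
    (exp_wedge (pullback j u) [seq dual_map j g | g <- fs1]).
Proof.
move=> hu [phi0 repE] free1 fs2_0; have hju := pullback_homogeneous2 hu.
have P0 : \prod_(f <- fs1 ++ fs2) form1 f != 0.
  by apply: contraNneq phi0; rewrite /exp_wedge => ->; rewrite mulr0.
split; first by apply: contraNneq (prod_form1_neq0 free1) => /(ext_exp_lreg hju)->.
case=> w g'; have [h hE] := homogeneous2_contraction (j w) hu.
have jhE : form1 (dual_map j h) = contraction w (pullback j u).
  by rewrite contraction_pullback -hE pullback_form1.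
rewrite (clifford_exp_wedge (x := (w, g')) char0 hju jhE) ?prod_form1_neq0 //=.
have memE f : (j w, f) \in E <->
    (forall k, k \in fs1 ++ fs2 -> k (j w) = 0) /\ f + h \in <<fs1 ++ fs2>>%VS.
  by rewrite -repE (clifford_exp_wedge (x := (j w, f)) char0 hu hE).
split=> [[fw0]|/mem_restrictionP[f /memE[fw0 fhE] /= ->]]; last first.
  split=> [_ /mapP[k kfs ->]|].
    by rewrite comp_lfunE fw0 // mem_cat kfs.
  move: fhE; rewrite span_cat => /memv_addP[a afs [b bfs /(congr1 (dual_map j))]].
  rewrite !dual_mapD => ->.
  have -> : dual_map j b = 0.
    move/(coord_span (X := in_tuple fs2)): bfs => ->; rewrite linear_sum big1 // => i _.
    by rewrite linearZ /= fs2_0 ?scaler0 // mem_nth.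
  rewrite addr0 -limg_dual_map_span.
  by have := memv_img (linfun (dual_map j)) afs; rewrite lfunE.
rewrite -limg_dual_map_span => /memv_imgP[a afs]; rewrite lfunE => g'E.
(* Here [a] lifts [g' + dual_map j h] to the span of [fs1], so [a - h] lifts [g']. *)
apply/mem_restrictionP; exists (a - h) => /=; last first.
  by apply: (addIr (dual_map j h)); rewrite -dual_mapD subrK.
apply/memE; split=> [k|]; last by rewrite subrK span_cat (subvP (addvSl _ _)).
rewrite mem_cat => /orP[kfs|/fs2_0 jk0].
  by rewrite -[LHS]comp_lfunE fw0 //; apply/mapP; exists k.
by rewrite -[LHS]comp_lfunE -/(dual_map j k) jk0 zero_lfunE.
Qed.

End Restriction.

(** * Complex conjugation of spinors and of their annihilators *)

Section Conjugation.
Set Implicit Arguments.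
Unset Strict Implicit.
Variables (R : rcfType) (V : vectType R).
Local Notation VC := (complexification V).
Implicit Types (E : {vspace VC * 'Hom(VC, R[i]^o)}) (phi psi : ext R[i] (\dim {:VC})).
Implicit Types (x y : VC * 'Hom(VC, R[i]^o)).

Lemma conj_spinor1 : conj_spinor 1 = 1 :> ext R[i] (\dim {:VC}).
Proof.
rewrite /conj_spinor; have -> : ext_map conjc 1 = 1 :> ext R[i] (\dim {:VC}).
  by apply/ffunP => S; rewrite !ffunE rmorph_nat.
exact: ext_lift1.
Qed.

Lemma conj_spinor_var i : conj_spinor (ext_var _ i) =
  form1 (conj_dual (dual_basis i)) :> ext R[i] (\dim {:VC}).
Proof. by rewrite -conj_spinor_form1 form1_dual_basis. Qed.

Lemma conj_spinor0 : conj_spinor 0 = 0 :> ext R[i] (\dim {:VC}).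
Proof.
have := conj_spinor_semilinear (-1) (0 : ext R[i] (\dim {:VC})) 0.
by rewrite scaler0 addr0 rmorphN1 scaleN1r addNr.
Qed.

Lemma conj_spinorZ (k : R[i]) phi : conj_spinor (k *: phi) = conjc k *: conj_spinor phi.
Proof. by rewrite -[k *: phi]addr0 conj_spinor_semilinear conj_spinor0 addr0. Qed.

Lemma conj_spinorB phi psi :
  conj_spinor (phi - psi) = conj_spinor phi - conj_spinor psi.
Proof.
by rewrite addrC -scaleN1r conj_spinor_semilinear rmorphN1 scaleN1r addrC.
Qed.

Lemma conjVK : involutive (@conjV R V).
Proof. by move=> v; have /(congr1 fst) := conj_doubleK (v, 0). Qed.

Lemma conj_spinorK : involutive (@conj_spinor R V).
Proof.
apply: ext_ind => [k a b Ia Ib||i a Ia].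
- rewrite 2!conj_spinor_semilinear; apply: (f_equal2 +%R) => //.
  exact: (congr2 _ (conjcK k) Ia).
- by rewrite !conj_spinor1.
rewrite 2!conj_spinor_mul; apply: (congr2 *%R _ Ia).
rewrite conj_spinor_var conj_spinor_form1.
have /(congr1 snd)/= -> := conj_doubleK (0, dual_basis i).
exact: form1_dual_basis.
Qed.

Lemma contraction_conj v phi :
  contraction (conjV v) (conj_spinor phi) = conj_spinor (contraction v phi).
Proof.
move: phi; apply: ext_ind => [k a b Ia Ib||i a Ia].
- rewrite contraction_linear 2!conj_spinor_semilinear contraction_linear.
  by apply: (f_equal2 +%R) => //; exact: (congr1 _ Ia).
- by rewrite conj_spinor1 !contraction1 conj_spinor0.
rewrite conj_spinor_mul conj_spinor_var contraction_form1.
rewrite -form1_dual_basis contraction_form1 conj_dualE conjVK conj_spinorB.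
rewrite conj_spinorZ conj_spinor_mul conj_spinor_form1.
by congr (_ - _); exact: (congr1 _ Ia).
Qed.

Lemma clifford_conj x phi :
  clifford (conj_double x) (conj_spinor phi) = conj_spinor (clifford x phi).
Proof.
rewrite /clifford contraction_conj -conj_spinor_form1 -conj_spinor_mul.
by rewrite -[contraction x.1 phi in RHS]scale1r conj_spinor_semilinear rmorph1 scale1r.
Qed.

Lemma representative_conj E phi :
  representative E phi -> representative (conj_space E) (conj_spinor phi).
Proof.
move=> [phi0 repE]; split=> [|x].
  by apply: contraNneq phi0 => cphi0; rewrite -[phi]conj_spinorK cphi0 conj_spinor0.
rewrite mem_conj_space -repE -{1}[x]conj_doubleK clifford_conj.
split=> [c0|->]; last exact: conj_spinor0.
by rewrite -[LHS]conj_spinorK c0 conj_spinor0.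
Qed.

Lemma pairing_conj x y : pairing (conj_double x) (conj_double y) = conjc (pairing x y).
Proof.
rewrite /pairing !conj_dualE rmorphM rmorphD rmorphN fmorphV rmorph_nat.
by rewrite !conjVK.
Qed.

Lemma perp_conj E : (forall x, (forall y, y \in E -> pairing x y = 0) -> x \in E) ->
  forall x, (forall y, y \in conj_space E -> pairing x y = 0) -> x \in conj_space E.
Proof.
move=> perpE x perp; rewrite mem_conj_space; apply: perpE => y yE.
rewrite -[y]conj_doubleK pairing_conj perp ?rmorph0 //.
by rewrite mem_conj_space conj_doubleK.
Qed.

End Conjugation.

(** * Adapted spinors for a generalized complex structure and a real subspace *)

Theorem proposition3p4 (R : realType) (V : vectType R)
    (E : {vspace complexification V * 'Hom(complexification V, R[i]^o)})
    (W : {vspace V}) :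
  gc_structure E ->
  let VC := complexification V in
  let j := inclusion W in
  let adapted (u : ext R[i] (\dim {:VC})) (k : nat)
      (f : k.-tuple 'Hom(VC, R[i]^o)) (l : nat) : Prop :=
    [/\ ext_homogeneous 2 u,
        representative E (exp_wedge u f),
        (l <= k)%N,
        basis_of (ann (j @^-1: rho E)) [seq dual_map j g | g <- take l f]
      & basis_of (ann (rho E + limg j)) (drop l f)] in
  (exists (u : ext R[i] (\dim {:VC})) (k : nat)
     (f : k.-tuple 'Hom(VC, R[i]^o)) (l : nat), adapted u k f l) /\
  (forall (u : ext R[i] (\dim {:VC})) (k : nat)
     (f : k.-tuple 'Hom(VC, R[i]^o)) (l : nat), adapted u k f l ->
   let phiW :=
     exp_wedge (pullback j u) [seq dual_map j g | g <- take l f] in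
   representative (gc_restriction W E) phiW /\
   (gc_subspace W E <-> mukai phiW (conj_spinor phiW) != 0)).
Proof.
move=> [maxE _] VC j adapted.
have char0 : [pchar R[i]] =i pred0 by exact: Num.Theory.pchar_num.
split=> [|u k f l [hu repE _ B1 B2] phiW].
  have [u [fs1 [fs2 [hu repE B1 B2]]]] := exists_adapted_spinor j char0 maxE.
  exists u, (size (fs1 ++ fs2)), (in_tuple (fs1 ++ fs2)), (size fs1).
  split=> //=; first by rewrite size_cat leq_addr.
    by rewrite take_size_cat.
  by rewrite drop_size_cat.
have repW : representative (gc_restriction W E) phiW.
  apply: (representative_restriction char0 (fs2 := drop l f) hu).
  - by rewrite cat_take_drop.
  - exact: basis_free B1.
  (* The covectors after position [l] vanish on the image of [j], so their pullbacks are zero. *)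
  move=> g /(basis_mem B2)/mem_annP g0; apply/lfunP => w.
  rewrite comp_lfunE zero_lfunE g0 //.
  exact/(subvP (addvSr _ _))/memv_img/memvf.
split=> //; have repWc := representative_conj repW.
(* Maximality of the restriction is read off from its pure spinor [phiW]. *)
have perpW x : (forall y, y \in gc_restriction W E -> pairing x y = 0) ->
    x \in gc_restriction W E.
  have hju : ext_homogeneous 2 (pullback j u) := pullback_homogeneous2 j hu.
  exact: (perp_representative char0 hju (repW : representative _ (exp_wedge _ _))).
have perpWc := perp_conj perpW.
by split; [apply: capv_mukai | apply: mukai_capv].
Qed.
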